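(* Let $v\in(0,1]$ and $u\in\mathbb{N}^+$. The Gerber-Shiu function $\phi(u)$ is given by $$\phi(u)=\boldsymbol{\alpha}^\top\mathbf{\Phi}(u)\,\boldsymbol{e},$$ where $$\mathbf{\Phi}(u)=v\sum_{k=1}^\infty\sum_{m=k}^\infty \omega(k,m-k)\left(\mathbf{W}_v(u)\mathbf{R}_v^{k}-\mathbf{W}_v(u-k)\right)\mathbf{\Lambda}(m).$$
   Context: $\mathbb{N}=\{0,1,2,\dots\}$, $\mathbb{N}^+=\{1,2,\dots\}$, $\mathbb{R}^+=[0,\infty)$, $E=\{1,\dots,N\}$, $\boldsymbol{e}$ = column vector of ones. Risk process: $U_n=u+n-\sum_{i=1}^n Z_i$, with $U_0=u$ and $\mathbb{N}$-valued claims $Z_k$. The phase process $\{J_n\}_{n\in\mathbb{N}}$ is a homogeneous Markov chain on $E$, irreducible and positive recurrent with stationary distribution $\boldsymbol{\pi}$, and with initial distribution $\boldsymbol{\alpha}^\top=(\alpha_1,\dots,\alpha_N)$, $\alpha_i=\mathbb{P}(J_0=i)$. Given the past up to time $k-1$ and $J_{k-1}=i$, $(Z_k,J_k)$ has law $\lambda_{ij}(m)=\mathbb{P}(Z_1=m,J_1=j\mid J_0=i)$, $m=0,1,2,\dots$, with $\mathbb{E}(Z_1\mathbb{I}_{(J_1=j)}\mid J_0=i)<\infty$. Write $(\mathbf{\Lambda}(m))_{ij}=\lambda_{ij}(m)$. Thus $(U,J)$ is an upward skip-free Markov additive chain (MAC) with increment matrices $\mathbf{A}_m=\mathbf{\Lambda}(1-m)$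 for $m\le1$ and $\mathbf{A}_m=\mathbf{0}$ for $m\ge2$. It is assumed that $\mathbf{A}_1$ is non-singular and that the net profit condition $\boldsymbol{\pi}^\top\sum_{m\ge-1}m\mathbf{A}_{-m}\boldsymbol{e}<0$ holds. Ruin time: $\tau_0=\inf\{n\in\mathbb{N}:U_n\le0\}$ ($\inf\emptyset=\infty$). For a penalty function $\omega:\mathbb{N}^+\times\mathbb{N}\to\mathbb{R}^+$, the Gerber-Shiu function is $\phi(u):=\boldsymbol{\alpha}^\top\mathbf{\Phi}(u)\boldsymbol{e}$, where $\mathbf{\Phi}(u)$ has $(i,j)$-th element $$\phi_{ij}(u)=\mathbb{E}\left[v^{\tau_0}\,\omega(U_{\tau_0-1},|U_{\tau_0}|)\,\mathbb{I}_{(\tau_0<\infty,\,J_{\tau_0}=j)}\,\middle|\,J_0=i,U_0=u\right].$$ Let $\mathbf{F}(z)=\sum_{m=-1}^\infty z^m\mathbf{A}_{-m}$. Scale matrix: $\mathbf{W}_v(n)=\mathbf{0}$ for integers $n\le0$, and $\mathbf{W}_v(n)$, $n\ge1$, is determined by $\sum_{n=0}^\infty z^n\mathbf{W}_v(n)=(v\mathbf{F}(z)-\mathbf{I})^{-1}$, i.e. by expanding the right-hand side as a power series in $z$ and matching coefficients. The matrix $\mathbf{R}_v$: let $(\widetilde X,\widetilde J)$ be the time-reversed MAC, i.e. the MAC with $\widetilde X_0=0$ and increment matrices $\widetilde{\mathbf{A}}_m=\mathrm{diag}(\boldsymbol{\pi})^{-1}\mathbf{A}_m^\top\mathrm{diag}(\boldsymbol{\pi})$.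 Let $\widetilde\tau_1^+=\inf\{n\in\mathbb{N}:\widetilde X_n\ge1\}$ and $(\widetilde{\mathbf{G}}_v)_{ij}=\mathbb{E}(v^{\widetilde\tau_1^+}\mathbb{I}_{(\widetilde\tau_1^+<\infty,\,\widetilde J_{\widetilde\tau_1^+}=j)}\mid\widetilde J_0=i)$. Then $\mathbf{R}_v:=\mathrm{diag}(\boldsymbol{\pi})^{-1}\widetilde{\mathbf{G}}_v^\top\mathrm{diag}(\boldsymbol{\pi})$; it is the left solution of $\mathbf{F}(\cdot)=v^{-1}\mathbf{I}$, meaning $\sum_{m=-1}^\infty\mathbf{R}_v^m\mathbf{A}_{-m}=v^{-1}\mathbf{I}$.
   Formalization: The last factor Λ(m) is replaced by A_{-m} = Λ(m+1): ruin from level k with deficit m−k needs a claim m+1; the printed formula fails for N=1, v=u=1, ω=1, λ(0)=a, λ(1)=1−a (0<a<1), where ruin is impossible but the printed sum is (1−a)/a. *)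

(* Defs.v *)
From HB Require Import structures.
From mathcomp Require Import all_boot all_order all_algebra.
From mathcomp Require Import all_classical all_reals all_analysis.
Set Implicit Arguments.
Unset Strict Implicit.
Unset Printing Implicit Defensive.
Import Order.TTheory GRing.Theory Num.Theory.
Import numFieldNormedType.Exports.
Local Open Scope classical_set_scope.
Local Open Scope ring_scope.

(* The phase space E = {1, ..., N} is
   'I_N; distributions on E are row vectors, so the transposes of column
   vectors in products such as (pi^T A e) are already built in. *)

(* inf {n | p n}, with None standing for inf of the empty set = +oo. *)
Definition first_time (p : pred nat) : option nat :=
  if pselect (exists n, p n) is left h then Some (ex_minn h) else None.

Definition ones (R : realType) (N : nat) : 'cV[R]_N := const_mx 1.

Definition mx_series (R : realType) (N : nat) (B : nat -> 'M[R]_N) : 'M[R]_N :=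
  \matrix_(i, j) limn (series (fun k => B k i j)).

Definition is_distribution (R : realType) (N : nat) (a : 'rV[R]_N) : Prop :=
  (forall i, 0 <= a ord0 i) /\ \sum_i a ord0 i = 1.

Section Modulated.
Context (R : realType) (N : nat) (d : measure_display) (T : measurableType d).

(* The values of J_0, Y_1, J_1, ..., Y_n, J_n are prescribed by y and j. *)
Definition past (S : Type) (Y : nat -> T -> S) (J : nat -> T -> 'I_N)
    (n : nat) (y : nat -> S) (j : nat -> 'I_N) : set T :=
  [set w | (forall l, (l <= n)%N -> J l w = j l) /\
           (forall l, (1 <= l <= n)%N -> Y l w = y l)].

(* P i is the law of the process conditionally on J_0 = i.  Given the past up
   to time n, (Y_(n+1), J_(n+1)) has law s, b |-> K s (J_n) b.  Only Y_n with
   n >= 1 is meaningful.  S is countable in all uses, so it is enough to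
   require measurability and the Markov property on atoms. *)
Definition modulated (S : Type) (P : 'I_N -> probability T R)
    (Y : nat -> T -> S) (J : nat -> T -> 'I_N) (K : S -> 'M[R]_N) : Prop :=
  [/\ forall n s, measurable [set w | Y n.+1 w = s],
      forall n j, measurable [set w | J n w = j],
      forall i, P i [set w | J 0%N w = i] = 1%E &
      forall i n y j s b,
        P i (past Y J n y j `&` [set w | Y n.+1 w = s /\ J n.+1 w = b]) =
        (P i (past Y J n y j) * (K s (j n) b)%:E)%E].

Definition is_MAC (P : 'I_N -> probability T R)
    (X : nat -> T -> int) (J : nat -> T -> 'I_N) (A : int -> 'M[R]_N) : Prop :=
  (forall w, X 0%N w = 0) /\
  modulated P (fun n w => X n w - X n.-1 w) J A.

(* Expected time of the first return of J to its initial state. *)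
Definition mean_return_time (P : 'I_N -> probability T R)
    (J : nat -> T -> 'I_N) (i : 'I_N) : \bar R :=
  (\int[P i]_w (if first_time (fun n => (0 < n)%N && (J n w == i)) is Some n
                then n%:R%:E else +oo))%E.

Definition surplus (u : nat) (Z : nat -> T -> nat) (n : nat) (w : T) : int :=
  u%:Z + n%:Z - \sum_(1 <= k < n.+1) (Z k w)%:Z.

Definition ruin_time (u : nat) (Z : nat -> T -> nat) (w : T) : option nat :=
  first_time (fun n => surplus u Z n w <= 0).

(* For u >= 1 ruin cannot occur at time 0 and the surplus prior to ruin is
   positive, so n.-1 and the first absolute value are harmless. *)
Definition penalty (v : R) (omega : nat -> nat -> R) (u : nat)
    (Z : nat -> T -> nat) (J : nat -> T -> 'I_N) (j : 'I_N) (w : T) : R :=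
  if ruin_time u Z w is Some n then
    v ^+ n * omega `|surplus u Z n.-1 w|%N `|surplus u Z n w|%N
      * (J n w == j)%:R
  else 0.

(* Takes values in [0, +oo], since omega need not be bounded. *)
Definition gerber_shiu_mx (P : 'I_N -> probability T R) (v : R)
    (omega : nat -> nat -> R) (Z : nat -> T -> nat) (J : nat -> T -> 'I_N)
    (u : nat) (i j : 'I_N) : \bar R :=
  ('E_(P i)[penalty v omega u Z J j])%E.

Definition gerber_shiu (alpha : 'rV[R]_N) (P : 'I_N -> probability T R) (v : R)
    (omega : nat -> nat -> R) (Z : nat -> T -> nat) (J : nat -> T -> 'I_N)
    (u : nat) : \bar R :=
  (\sum_i \sum_j (alpha ord0 i)%:E * gerber_shiu_mx P v omega Z J u i j)%E.

(* First passage transform; [fine] is harmless because for 0 < v <= 1 the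
   expectation lies in [0, 1]. *)
Definition passage_mx (P : 'I_N -> probability T R) (v : R)
    (X : nat -> T -> int) (J : nat -> T -> 'I_N) : 'M[R]_N :=
  \matrix_(i, j) fine ('E_(P i)[(fun w =>
    if first_time (fun n => 1 <= X n w) is Some n
    then v ^+ n * (J n w == j)%:R else 0)%R])%E.

End Modulated.

Section Matrices.
Context (R : realType) (N : nat).
Implicit Types (A W : int -> 'M[R]_N) (Lambda : nat -> 'M[R]_N).

Definition is_kernel Lambda : Prop :=
  (forall m i j, 0 <= Lambda m i j) /\
  forall i, series (fun m => \sum_j Lambda m i j) @ \oo --> (1 : R).

Definition phase_mx Lambda : 'M[R]_N := mx_series Lambda.

Definition irreducible (Q : 'M[R]_N) : Prop :=
  forall i j, exists n, 0 < (Q ^+ n) i j.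

Definition is_stationary (q : 'rV[R]_N) (Q : 'M[R]_N) : Prop :=
  is_distribution q /\ q *m Q = q.

Definition increment_mx Lambda (m : int) : 'M[R]_N :=
  if m <= 1 then Lambda `|1 - m|%N else 0.

(* In this and the next definition the summation index m >= -1 is k - 1. *)
Definition net_drift (q : 'rV[R]_N) A : R :=
  (q *m mx_series (fun k => (k%:Z - 1)%:~R *: A (- (k%:Z - 1))) *m ones R N)
    ord0 ord0.

Definition F_mx A (z : R) : 'M[R]_N :=
  mx_series (fun k => z ^ (k%:Z - 1) *: A (- (k%:Z - 1))).

(* F has a simple pole at 0, hence the punctured neighbourhood; this property
   determines W. *)
Definition is_scale_matrix (v : R) A W : Prop :=
  (forall n : int, n <= 0 -> W n = 0) /\
  \forall z \near (0 : R)^',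
    (v *: F_mx A z - 1%:M) \in unitmx /\
    forall i j, series (fun n : nat => z ^+ n * W n%:Z i j) @ \oo -->
      (invmx (v *: F_mx A z - 1%:M) i j : R).

Definition reversal (q : 'rV[R]_N) (B : 'M[R]_N) : 'M[R]_N :=
  invmx (diag_mx q) *m B^T *m diag_mx q.

End Matrices.

(* Main.v *)
Require Import Defs.
From HB Require Import structures.
From mathcomp Require Import all_boot all_order all_algebra.
From mathcomp Require Import all_classical all_reals all_analysis.
From mathcomp Require Import measurable_realfun.
From mathcomp Require Import ring lra zify.
Set Implicit Arguments.
Unset Strict Implicit.
Unset Printing Implicit Defensive.
Import Order.TTheory GRing.Theory Num.Theory.
Import numFieldNormedType.Exports.
Local Open Scope classical_set_scope.
Local Open Scope ring_scope.

(** Let [G u k] be the matrix of discounted expected numbers of visits to level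
    [k] before ruin, started from level [u]:
      [G u k = sum_n v^n P(U_n = k, J_n = _, no ruin up to time n)].
    Ruin from level [k] is caused by a claim [m + 1] with [m >= k], so summing
    over the last level before ruin and over the claim gives
      [Phi u = v sum_(k >= 1) sum_(m >= k) omega k (m - k) G u k A_(-m)],
    and the theorem amounts to [G u k = W u R^k - W (u - k)].

    Two facts give this identity.

    - First-step analysis. For [u >= 1], conditioning on the first claim gives
      [G u k = I [u = k] + v sum_m A_(-m) G (u - m) k], the sum running over
      the positive levels [u - m].  Comparing coefficients in
      [(v F(z) - I) (v F(z) - I)^-1 = I] shows that [W u] satisfies the
      homogeneous equation and that [v A_1 W 1 = I]; since the index is shifted
      by [k] and [W] vanishes on [n <= 0], [u |-> W u R^k - W (u - k)] satisfies
      the same equation as [G].  Walks go up by at most one level and [A_1] is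
      invertible, so the equation determines the value at [u + 1] from those
      below, and only the value at [u = 1] has to be compared:
      [v A_1 G 1 k = R^k] ([green_scale]).

    - Excursions above level 0. The matrix [v A_1 G 1 k] sums the discounted
      weights of the paths from level 0 to level [k] that stay positive after
      time 0.  A last exit decomposition factorizes these paths into [k] unit
      passages, so that [v A_1 G 1 k] is the [k]-th power of [v A_1 G 1 1]
      ([taboo_last_exit], [green0_pow]).  For [k = 1], expanding the
      law of the first passage of the time-reversed chain by its last step
      produces the matrices of the first-step expansion of [v A_1 G 1 1],
      transposed and conjugated by [diag_mx q] ([alive_passage],
      [passage_mx_sums]).

    The finiteness of [G] comes from the same identities: [v A_1 G 1 1 = R] is
    finite because first passage transforms are at most 1, [G 1 k] is then
    finite by the factorization, and [G u k] by the first-step equation; in the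
    first and the last stage [A_1] is removed because a nonsingular nonnegative matrix has no zero
    column ([unitmx_summable]).

    The probabilistic input is the same for the risk process and for the
    reversed chain: a walk whose increments are functions of the modulated
    sequence, watched until it leaves the positive levels ([aliveS] and
    [expectation_exit]).  Positive levels [l] are indexed by [x = l - 1]
    throughout, so that the natural numbers enumerate them. *)

(** * Asymptotic expansions at 0 *)

Section Expansion.
Context (R : realType).
Implicit Types (f g : R -> R) (a b : nat -> R) (p r : {poly R}).

Definition bigO_at0 f M : Prop :=
  exists C : R, \forall z \near (0 : R)^', `|f z| <= C * `|z| ^+ M.

(** The polynomial is allowed to have further terms of degree at least [M]:
    products of truncations then need not be truncated again. *)
Definition expansion f a : Prop :=
  forall M, exists2 p : {poly R}, (forall n, (n < M)%N -> p`_n = a n) &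
    bigO_at0 (fun z => f z - p.[z]) M.

Lemma bigO_at0D f g M : bigO_at0 f M -> bigO_at0 g M ->
  bigO_at0 (fun z => f z + g z) M.
Proof.
move=> [C fC] [D gD]; exists (C + D); near=> z.
rewrite (le_trans (ler_normD _ _))// mulrDl lerD//; [near: z; exact: fC|].
by near: z; exact: gD.
Unshelve. all: by end_near. Qed.

Lemma bigO_at0M f g M N : bigO_at0 f M -> bigO_at0 g N ->
  bigO_at0 (fun z => f z * g z) (M + N).
Proof.
move=> [C fC] [D gD]; exists (C * D); near=> z.
rewrite normrM exprD mulrACA ler_pM//; [near: z; exact: fC|].
by near: z; exact: gD.
Unshelve. all: by end_near. Qed.

Lemma bigO_at0_poly p : bigO_at0 (fun z => p.[z]) 0.
Proof.
have pc : p.[z] @[z --> (0 : R)^'] --> p.[0].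
  by apply: cvg_within_filter; exact: continuous_horner.
have [C pC] := (ex_bound _).1 (cvg_bounded _ _ pc).
by exists C; near=> z; rewrite expr0 mulr1; near: z; exact: pC.
Unshelve. all: by end_near. Qed.

Lemma bigO_at0_cst c (f : R -> R) : (forall z, f z = c) -> bigO_at0 f 1 -> c = 0.
Proof.
move=> fc [C fC]; apply/eqP; rewrite -normr_le0.
have h : (C * `|z|) @[z --> (0 : R)] --> C * `|0 : R|.
  by apply: cvgM; [exact: cvg_cst|exact: cvg_norm].
have h0 : (C * `|z|) @[z --> (0 : R)^'] --> C * `|0 : R| by exact: cvg_within_filter h.
rewrite normr0 mulr0 in h0; apply: (cvgr_to_ge h0).
by near=> z; rewrite -(fc z) -[`|z|]expr1; near: z.
Unshelve. all: by end_near. Qed.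

(** The bound is only known off the origin, but continuity of the polynomial
    at 0 still kills its constant term; divide by ['X] and repeat. *)
Lemma bigO_at0_coef p M : bigO_at0 (fun z => p.[z]) M ->
  forall n, (n < M)%N -> p`_n = 0.
Proof.
elim: M p => [//|M IH] p [C pC].
pose s := \poly_(i < (size p).-1) p`_i.+1.
have ps : p = s * 'X + (p`_0)%:P.
  apply/polyP => -[|n]; rewrite coefD coefMX coefC/= ?add0r// addr0 coef_poly.
  case: ltnP => // h; rewrite nth_default//.
  by case: (size p) h.
have p0 : p`_0 = 0.
  apply: (@bigO_at0_cst _ (fun z => p.[z] - s.[z] * z)).
    by move=> z; rewrite {1}ps hornerMXaddC addrC addKr.
  apply: bigO_at0D.
    exists `|C|; near=> z; rewrite (@le_trans _ _ (C * `|z| ^+ M.+1))//.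
      by near: z; exact: pC.
    rewrite (le_trans (ler_norm _))// normrM expr1 ler_wpM2l//.
    rewrite ger0_norm ?exprn_ge0// exprS ler_piMr// exprn_ile1//.
    by near: z; apply: dnbhs0_le.
  have [D sD] := bigO_at0_poly s; exists D; near=> z.
  rewrite normrN normrM expr1 ler_wpM2r//.
  by near: z; move: sD; apply: filterS => w; rewrite expr0 mulr1.
case=> [//|n nM]; have -> : p`_n.+1 = s`_n.
  by rewrite [in LHS]ps coefD coefMX coefC/= addr0.
apply: IH => //; exists C; near=> z.
have z0 : 0 < `|z| by rewrite normr_gt0; near: z; exact: nbhs_dnbhs_neq.
rewrite -(ler_pM2r z0) -mulrA -exprSr -normrM.
have -> : s.[z] * z = p.[z] by rewrite [in RHS]ps p0 hornerMXaddC addr0.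
by near: z; exact: pC.
Unshelve. all: by end_near. Qed.

Lemma expansion_uniq f a b : expansion f a -> expansion f b -> a =1 b.
Proof.
move=> fa fb n; have [p pa pO] := fa n.+1; have [r rb rO] := fb n.+1.
rewrite -pa// -rb//; apply/eqP; rewrite -subr_eq0 -coefB; apply/eqP.
apply: (@bigO_at0_coef (p - r) n.+1) => //.
have [C pC] := pO; have rpO : bigO_at0 (fun z => - (f z - p.[z])) n.+1.
  by exists C; near=> z; rewrite normrN; near: z.
have [D h] := bigO_at0D rO rpO; exists D.
near=> z; suff -> : (p - r).[z] = f z - r.[z] - (f z - p.[z]) by near: z.
by rewrite hornerD hornerN; ring.
Unshelve. all: by end_near. Qed.

Lemma near_expansion f g a : (\forall z \near (0 : R)^', f z = g z) ->
  expansion f a -> expansion g a.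
Proof.
move=> fg fa M; have [p pa [C pC]] := fa M; exists p => //; exists C.
near=> z; have <- : f z = g z by near: z.
by near: z.
Unshelve. all: by end_near. Qed.

Lemma expansion_poly p : expansion (fun z => p.[z]) (fun n => p`_n).
Proof.
move=> M; exists p => //; exists 0; near=> z.
by rewrite subrr normr0 mul0r.
Unshelve. all: by end_near. Qed.

Lemma expansionD f g a b : expansion f a -> expansion g b ->
  expansion (fun z => f z + g z) (fun n => a n + b n).
Proof.
move=> fa gb M; have [p pa pO] := fa M; have [r rb rO] := gb M.
exists (p + r) => [n nM|]; first by rewrite coefD pa// rb.
have [C h] := bigO_at0D pO rO; exists C; near=> z.
suff -> : f z + g z - (p + r).[z] = f z - p.[z] + (g z - r.[z]) by near: z.
by rewrite hornerD; ring.
Unshelve. all: by end_near. Qed.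

Lemma expansion_sum (I : finType) (f : I -> R -> R) (a : I -> nat -> R) :
  (forall i, expansion (f i) (a i)) ->
  expansion (fun z => \sum_i f i z) (fun n => \sum_i a i n).
Proof.
move=> fa; elim: (index_enum I) => [|i s IH].
  have := @expansion_poly 0; congr expansion; apply/funext => z.
    by rewrite big_nil horner0.
  by rewrite big_nil coef0.
have := expansionD (fa i) IH; congr expansion; apply/funext => z.
  by rewrite big_cons.
by rewrite big_cons.
Qed.

(** Truncating both factors makes the product rule the one of polynomials. *)
Lemma expansionM f g a b : expansion f a -> expansion g b ->
  expansion (fun z => f z * g z)
    (fun n => \sum_(k < n.+1) a k * b (n - k)%N).
Proof.
move=> fa gb M; have [p pa pO] := fa M; have [r rb rO] := gb M.
exists (p * r) => [n nM|].
  rewrite coefM; apply: eq_bigr => -[k/= kn] _.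
  by rewrite pa ?rb//; lia.
have [f0 _ fO] := fa 0%N.
have fbd : bigO_at0 f 0.
  have [C h] := bigO_at0D fO (bigO_at0_poly f0); exists C; near=> z.
  by rewrite -[f z](subrK f0.[z]); near: z.
have h1 := bigO_at0M fbd rO; have h2 := bigO_at0M pO (bigO_at0_poly r).
rewrite add0n in h1; rewrite addn0 in h2.
have [C h] := bigO_at0D h1 h2; exists C; near=> z.
suff -> : f z * g z - (p * r).[z] =
  f z * (g z - r.[z]) + (f z - p.[z]) * r.[z] by near: z.
by rewrite hornerM; ring.
Unshelve. all: by end_near. Qed.

(** Convergence at a single [z0 <> 0] bounds the terms, so the tail at
    [|z| <= |z0| / 2] is dominated by a geometric series. *)
Lemma expansion_series f a :
  (\forall z \near (0 : R)^', series (fun n => z ^+ n * a n) @ \oo --> f z) ->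
  expansion f a.
Proof.
move=> fa M; exists (\poly_(n < M) a n) => [n nM|]; first by rewrite coef_poly nM.
have [z0 [z00 cz0]] : exists z0 : R, z0 != 0 /\
    (series (fun n => z0 ^+ n * a n) @ \oo --> f z0).
  have /filter_ex[z [h1 h2]] : \forall z \near (0 : R)^', z != 0 /\
      (series (fun n => z ^+ n * a n) @ \oo --> f z).
    by near=> z; split; near: z => //; exact: nbhs_dnbhs_neq.
  by exists z.
have nz0 : 0 < `|z0| by rewrite normr_gt0.
have [B aB] : exists B : R, forall n, `|z0 ^+ n * a n| <= B.
  have [B [_ hB]] := cvg_series_bounded (cvgP _ cz0).
  by exists (B + 1) => n; apply: hB => //; rewrite ltrDl.
have B0 : 0 <= B by rewrite (le_trans _ (aB 0%N)).
exists (2 * B / `|z0| ^+ M); near=> z.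
have zn0 : 0 < `|z| by rewrite normr_gt0; near: z; exact: nbhs_dnbhs_neq.
have z_le : `|z| <= `|z0| / 2.
  by near: z; apply: dnbhs0_le; rewrite divr_gt0.
have cz : series (fun n => z ^+ n * a n) @ \oo --> f z by near: z.
have tail n : `|series (fun n => z ^+ n * a n) (M + n)%N - (\poly_(n < M) a n).[z]|
    <= 2 * B / `|z0| ^+ M * `|z| ^+ M.
  rewrite horner_poly addnC series_addn /series/= big_mkord.
  rewrite (eq_bigr (fun i : 'I_M => a i * z ^+ i)); last by move=> i _; rewrite mulrC.
  rewrite addrC addKr (le_trans (ler_norm_sum _ _ _))//.
  have le1 k : `|z ^+ k * a k| <= B * (`|z| / `|z0|) ^+ k.
    have -> : z ^+ k * a k = z0 ^+ k * a k * (z / z0) ^+ k.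
      by rewrite exprMn exprVn; field; rewrite expf_eq0 negb_and z00 orbT.
    by rewrite normrM [`|(z / z0) ^+ k|]normrX normf_div ler_wpM2r ?exprn_ge0 ?divr_ge0.
  rewrite (@le_trans _ _ (\sum_(M <= k < n + M) B * (`|z| / `|z0|) ^+ k))//.
    by apply: ler_sum.
  set x := `|z| / `|z0|.
  have x0 : 0 < x by rewrite divr_gt0.
  have x2 : x <= 2^-1 by rewrite ler_pdivrMr// mulrC.
  rewrite -big_distrr/= addnC geometric_partial_tail.
  have x1 : `|x| < 1 by rewrite gtr0_norm// (le_lt_trans x2)// invf_lt1 ?ltr1n.
  rewrite (@le_trans _ _ (B * (x ^+ M * (1 - x)^-1)))//.
    by rewrite ler_wpM2l// geometric_le_lim// exprn_ge0 ?ltW.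
  have -> : 2 * B / `|z0| ^+ M * `|z| ^+ M = B * (x ^+ M * 2).
    by rewrite exprMn exprVn; ring.

  have x_half : (1 - x)^-1 <= 2 by rewrite -[X in _ <= X]invrK lef_pV2 ?posrE; lra.
  by rewrite !ler_wpM2l ?exprn_ge0 ?(ltW x0).
have : (fun n => `|series (fun n => z ^+ n * a n) (M + n)%N -
    (\poly_(n < M) a n).[z]|) @ \oo --> `|f z - (\poly_(n < M) a n).[z]|.
  apply: cvg_norm; apply: cvgB; last exact: cvg_cst.
  have := cz; rewrite -(cvg_shiftn M); apply: cvg_trans.
  by apply: near_eq_cvg; near=> n; rewrite addnC.
by move=> /cvgr_to_le; apply; near=> n; exact: tail.
Unshelve. all: by end_near. Qed.

End Expansion.

(** * Recursion for the scale matrix *)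

Section ScaleMatrix.
Context (R : realType) (N : nat).
Implicit Types (Lambda : nat -> 'M[R]_N) (W : int -> 'M[R]_N).

Lemma increment_mxE Lambda (d : int) k : d + k%:Z = 1 ->
  increment_mx Lambda d = Lambda k.
Proof.
move=> dk; rewrite /increment_mx; case: ifPn => [_|]; last by lia.
by congr Lambda; lia.
Qed.

Lemma increment_mx_gt1 Lambda (d : int) : 1 < d -> increment_mx Lambda d = 0.
Proof. by rewrite ltNge /increment_mx => /negbTE ->. Qed.

Lemma increment_mx_ge0 Lambda d i j : is_kernel Lambda ->
  0 <= increment_mx Lambda d i j.
Proof. by move=> [h _]; rewrite /increment_mx; case: ifP => // _; rewrite mxE. Qed.

Lemma kernel_summable Lambda i j : is_kernel Lambda ->
  cvgn (series (fun k => Lambda k i j)).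
Proof.
move=> [L0 L1]; apply: series_le_cvg (cvgP _ (L1 i)) => n //.
  by apply: sumr_ge0.
by rewrite (bigD1 j)//= lerDl sumr_ge0.
Qed.

Lemma expansion_F Lambda i j : is_kernel Lambda ->
  expansion (fun z => z * F_mx (increment_mx Lambda) z i j)
    (fun k => Lambda k i j).
Proof.
move=> kL; apply: expansion_series; near=> z.
have z0 : z != 0 by near: z; exact: nbhs_dnbhs_neq.
have z1 : `|z| <= 1 by near: z; exact: dnbhs0_le.
have cz : cvgn (series (fun k => z ^+ k * Lambda k i j)).
  apply: normed_cvg.
  apply: (@series_le_cvg _ _ (fun k => Lambda k i j)) => [n|n|n|] //=;
    last exact: kernel_summable.
  - by case: kL.
  - have L0 := kL.1 n i j; rewrite normrM normrX (ger0_norm L0).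
    by rewrite ler_piMl// exprn_ile1.
rewrite /F_mx mxE.
have -> : (fun k => (z ^ (k%:Z - 1) *: increment_mx Lambda (- (k%:Z - 1))) i j) =
    z^-1 *: (fun k => z ^+ k * Lambda k i j).
  apply/funext => k; rewrite mxE (@increment_mxE _ _ k); last by lia.
  rewrite [RHS](_ : _ = z^-1 * (z ^+ k * Lambda k i j))// expfzDr//.
  by rewrite -[z ^ (-1)]/(z^-1) -[z ^ k%:Z]/(z ^+ k) mulrAC mulrC.
rewrite lim_seriesZ//.
by rewrite [X in _ --> X](_ : _ = limn (series (fun k => z ^+ k * Lambda k i j)))
  // /GRing.scale/= mulrA divff ?mul1r.
Unshelve. all: by end_near. Qed.

(** Multiplying [v F(z) - I] by [z] removes its pole, so the coefficients of
    [z (v F(z) - I) (v F(z) - I)^-1 = z I] can be compared. *)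
Lemma scale_matrix_coef (v : R) Lambda W : is_kernel Lambda ->
  is_scale_matrix v (increment_mx Lambda) W -> forall n,
  \sum_(k < n.+1) (v *: Lambda k - (k == 1%N :> nat)%:R%:M) *m W (n - k)%N%:Z =
  (n == 1%N)%:R%:M.
Proof.
move=> kL [_ WF] n; apply/matrixP => i j; set A := increment_mx Lambda in WF.
pose M z := v *: F_mx A z - 1%:M.
have invE l : expansion (fun z => invmx (M z) l j) (fun n => W n%:Z l j).
  by apply: expansion_series; move: WF; apply: filterS => z [_ +]; apply.
have ME l : expansion (fun z => z * M z i l)
    (fun k => v * Lambda k i l - (k == 1%N)%:R * (i == l)%:R).
  have := expansionD (expansionM (expansion_poly v%:P) (expansion_F i l kL))
    (expansion_poly (- (i == l)%:R *: 'X)).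
  congr expansion; apply/funext => z.
    rewrite !mxE hornerC hornerZ hornerX; ring.
  rewrite coefZ coefX mulNr [X in _ - X]mulrC; congr (_ - _).
  rewrite big_ord_recl coefC/= subn0 big1 ?addr0// => k _.
  by rewrite coefC mul0r.
(* two expansions of the (i, j) entry of z I *)
have h := expansion_sum (fun l => expansionM (ME l) (invE l)).
have h' : expansion (fun z => \sum_l z * M z i l * invmx (M z) l j)
    (fun n => ((i == j)%:R *: 'X : {poly R})`_n).
  apply: near_expansion (expansion_poly _); move: WF; apply: filterS => z [Mu _].
  rewrite hornerZ hornerX.
  under eq_bigr do rewrite -mulrA; rewrite -big_distrr/=.
  have /matrixP/(_ i j) := mulmxV Mu; rewrite !mxE => ->.
  by rewrite mulrC -mulr_natr mul1r.
have := expansion_uniq h h' n; rewrite coefZ coefX mxE => e.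
rewrite summxE (eq_bigr (fun k : 'I_n.+1 => \sum_l
  (v * Lambda k i l - (k == 1%N :> nat)%:R * (i == l)%:R) * W (n - k)%N%:Z l j)).
  rewrite exchange_big/= e; case: (i == j); case: (n == 1%N);
    by rewrite ?mulr1 ?mulr0 ?mulr1n ?mulr0n// ?mul1r.
move=> k _; rewrite mxE; apply: eq_bigr => l _; congr (_ * _).
by rewrite !mxE; case: (i == l); rewrite ?mulr1 ?mulr1n ?mulr0.
Qed.

Lemma scale_matrix1 (v : R) Lambda W : is_kernel Lambda ->
  is_scale_matrix v (increment_mx Lambda) W ->
  v *: (increment_mx Lambda 1 *m W 1) = 1%:M.
Proof.
move=> kL sW; have := scale_matrix_coef kL sW 1; rewrite big_ord_recl big_ord1/=.
rewrite (sW.1 (1 - bump 0 0)%N%:Z)// mulmx0 addr0 raddf0 subr0 => <-.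
by rewrite scalemxAl (@increment_mxE _ _ 0).
Qed.

(** Above level 0 the scale matrix is harmonic for the walk killed with
    probability [1 - v] at each step and on leaving the positive levels. *)
Lemma scale_matrix_harmonic (v : R) Lambda W x : is_kernel Lambda ->
  is_scale_matrix v (increment_mx Lambda) W ->
  v *: (\sum_(z < x.+2) increment_mx Lambda (z%:Z - x%:Z) *m W z.+1%:Z) =
  W x.+1%:Z.
Proof.
move=> kL sW; have := scale_matrix_coef kL sW x.+2.
have s0 : (0 : R)%:M = 0 :> 'M[R]_N by rewrite raddf0.
rewrite s0 big_ord_recr/= subnn sW.1// mulmx0 addr0.
under eq_bigr do rewrite mulmxBl.
rewrite sumrB => /eqP; rewrite subr_eq0 => /eqP e.
rewrite [LHS](_ : _ = \sum_(k < x.+2) v *: Lambda k *m W (x.+2 - k)%N%:Z).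
  rewrite e big_ord_recl/= s0 mul0mx add0r big_ord_recl/= mul1mx big1.
    by rewrite addr0; congr W; rewrite /bump/=; lia.
  by move=> k _; rewrite /bump/= s0 mul0mx.
rewrite scaler_sumr (reindex_inj rev_ord_inj)/=; apply: eq_bigr => k _.
rewrite -scalemxAl (@increment_mxE _ _ k); last by have := ltn_ord k; lia.
by congr (_ *: (_ *m W _)); have := ltn_ord k; lia.
Qed.

End ScaleMatrix.

(** * Entrywise convergent series of matrices *)

Lemma cvgr_sum (R : realType) (I : Type) (s : seq I) (f : I -> nat -> R)
    (l : I -> R) : (forall i, f i @ \oo --> l i) ->
  (fun n => \sum_(i <- s) f i n) @ \oo --> \sum_(i <- s) l i.
Proof.
move=> fl; elim: s => [|i s IH].
  by under eq_fun do rewrite big_nil; rewrite big_nil; exact: cvg_cst.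
under eq_fun do rewrite big_cons; rewrite big_cons.
by apply: cvgD; [exact: fl|exact: IH].
Qed.

Section MatrixSeries.
Context (R : realType) (N : nat).
Implicit Types (B C : nat -> 'M[R]_N) (S T M : 'M[R]_N).

(** A one-constructor type instead of a transparent definition, so that the
    quantifiers hidden in the limits stay out of the implicit arguments. *)
Variant mx_sums B S : Prop :=
  MxSums of forall i j, series (fun k => B k i j) @ \oo --> (S i j : R).

Lemma mx_sumsP B S i j : mx_sums B S ->
  series (fun k => B k i j) @ \oo --> (S i j : R).
Proof. by case. Qed.
Arguments mx_sumsP {B S} i j _ _ _.

Lemma mx_sums_series B : (forall i j, cvgn (series (fun k => B k i j))) ->
  mx_sums B (mx_series B).
Proof. by move=> h; split=> i j; rewrite mxE; exact: h. Qed.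

Lemma mx_sums_uniq B S T : mx_sums B S -> mx_sums B T -> S = T.
Proof.
move=> BS BT; apply/matrixP => i j.
by have := cvg_unique _ (mx_sumsP i j BS) (mx_sumsP i j BT); apply; exact: norm_hausdorff.
Qed.

Lemma mx_sumsD B C S T : mx_sums B S -> mx_sums C T ->
  mx_sums (fun n => B n + C n) (S + T).
Proof.
move=> BS CT; split=> i j; rewrite mxE.
rewrite [series _](_ : _ = fun n =>
    series (fun k => B k i j) n + series (fun k => C k i j) n).
  by apply: cvgD; exact: mx_sumsP.
apply/funext => n; rewrite /series/= -big_split/=.
by apply: eq_bigr => k _; rewrite mxE.
Qed.

Lemma mx_sums_eq B C S : B =1 C -> mx_sums B S -> mx_sums C S.
Proof. by move=> /funext ->. Qed.

Lemma mx_sums_mull M B S : mx_sums B S -> mx_sums (fun n => M *m B n) (M *m S).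
Proof.
move=> BS; split=> i j; rewrite mxE.
rewrite [series _](_ : _ = fun n => \sum_l M i l * series (fun k => B k l j) n).
  by apply: cvgr_sum => l; apply: cvgM; [exact: cvg_cst|exact: mx_sumsP].
apply/funext => n; rewrite /series/=; under eq_bigr do rewrite mxE.
by rewrite exchange_big/=; apply: eq_bigr => l _; rewrite big_distrr.
Qed.

Lemma mx_sums_mulr M B S : mx_sums B S -> mx_sums (fun n => B n *m M) (S *m M).
Proof.
move=> BS; split=> i j; rewrite mxE.
rewrite [series _](_ : _ = fun n => \sum_l series (fun k => B k i l) n * M l j).
  by apply: cvgr_sum => l; apply: cvgM; [exact: mx_sumsP|exact: cvg_cst].
apply/funext => n; rewrite /series/=; under eq_bigr do rewrite mxE.
by rewrite exchange_big/=; apply: eq_bigr => l _; rewrite big_distrl.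
Qed.

Lemma mx_sums_sum (I : finType) (B : I -> nat -> 'M[R]_N) (S : I -> 'M[R]_N) :
  (forall a, mx_sums (B a) (S a)) ->
  mx_sums (fun n => \sum_a B a n) (\sum_a S a).
Proof.
move=> BS; elim: (index_enum I) => [|a s IH].
  apply: (@mx_sums_eq (fun=> 0)) => [n|]; first by rewrite big_nil.
  split=> i j; rewrite big_nil mxE; apply: cvg_near_cst; near=> n.
  by rewrite /series/= big1// => k _; rewrite mxE.
rewrite big_cons; apply: mx_sums_eq (mx_sumsD (BS a) IH) => n.
by rewrite big_cons.
Unshelve. all: by end_near. Qed.

Lemma mx_sums_recl B S : mx_sums (fun n => B n.+1) S -> mx_sums B (B 0%N + S).
Proof.
move=> BS; split=> i j; rewrite mxE -cvg_shiftS.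
rewrite [X in X @ \oo](_ : _ = fun n => B 0%N i j + series (fun k => B k.+1 i j) n).
  by apply: cvgD; [exact: cvg_cst|exact: mx_sumsP].
by apply/funext => n; rewrite /series/= big_nat_recl.
Qed.

(** The partial sums of the convolution are squeezed by evaluating at 1 the
    products of the truncated polynomials. *)
Lemma cauchy_product (x y : nat -> R) (X Y : R) :
  (forall n, 0 <= x n) -> (forall n, 0 <= y n) ->
  series x @ \oo --> X -> series y @ \oo --> Y ->
  series (fun n => \sum_(a < n.+1) x a * y (n - a)%N) @ \oo --> X * Y.
Proof.
move=> x0 y0 xX yY; set c := fun n => _.
pose p (z : nat -> R) n := \poly_(a < n) z a.
have pE z n : (p z n).[1] = series z n.
  rewrite horner_poly /series/= big_mkord; apply: eq_bigr => a _.
  by rewrite expr1n mulr1.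
have p0 (z : nat -> R) n a : (forall n, 0 <= z n) -> 0 <= (p z n)`_a <= z a.
  by move=> z0; rewrite coef_poly; case: ifP; rewrite ?z0 ?lexx.
have c0 n : 0 <= c n by apply: sumr_ge0 => a _; rewrite mulr_ge0.
have cmono : nondecreasing_seq (series c) by exact: nondecreasing_series.
have lec n k : 0 <= (p x n * p y n)`_k <= c k.
  rewrite coefM; apply/andP; split.
    by apply: sumr_ge0 => a _; rewrite mulr_ge0//; [case/andP: (p0 x n a x0)|
      case/andP: (p0 y n (k - a)%N y0)].
  apply: ler_sum => a _; have /andP[? ?] := p0 x n a x0.
  by have /andP[? ?] := p0 y n (k - a)%N y0; exact: ler_pM.
have eqc n k : (k < n)%N -> (p x n * p y n)`_k = c k.
  move=> kn; rewrite coefM; apply: eq_bigr => -[a/= ak] _.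
  by rewrite !coef_poly !ifT//; lia.
have prodE n : series x n * series y n =
    \sum_(k < n + n) (p x n * p y n)`_k.
  rewrite -!pE -hornerM (@horner_coef_wide _ (n + n)).
    by apply: eq_bigr => k _; rewrite expr1n mulr1.
  rewrite (leq_trans (size_polyMleq _ _))// (leq_trans (leq_pred _))//.
  by rewrite leq_add// size_poly.
have le1 n : series c n <= series x n * series y n.
  rewrite prodE big_split_ord/= /series/= big_mkord.
  rewrite (eq_bigr (fun k : 'I_n => (p x n * p y n)`_k)) => [|k _]; last by rewrite eqc.
  by rewrite lerDl; apply: sumr_ge0 => k _; case/andP: (lec n (n + k)%N).
have le2 n : series x n * series y n <= series c (n + n)%N.
  rewrite prodE /series/= big_mkord; apply: ler_sum => k _.
  by case/andP: (lec n k).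
have xyXY : (fun n => series x n * series y n) @ \oo --> X * Y by exact: cvgM.
have xyle n : series x n * series y n <= X * Y.
  rewrite ler_pM//; try exact: sumr_ge0.
    rewrite -(cvg_lim _ xX)//; apply: nondecreasing_cvgn_le (cvgP _ xX) n.
    exact: nondecreasing_series.
  rewrite -(cvg_lim _ yY)//; apply: nondecreasing_cvgn_le (cvgP _ yY) n.
  exact: nondecreasing_series.
have cc : cvgn (series c).
  apply: nondecreasing_is_cvgn => //; exists (X * Y) => _ [n _ <-].
  exact: le_trans (le1 n) (xyle n).
suff -> : X * Y = limn (series c) by [].
apply/eqP; rewrite eq_le; apply/andP; split.
  apply: (cvgr_to_le xyXY); near=> n; apply: (le_trans (le2 n)).
  exact: nondecreasing_cvgn_le.
apply: limr_le => //; near=> n; exact: le_trans (le1 n) (xyle n).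
Unshelve. all: by end_near. Qed.

Lemma mx_sums_cauchy B C S T :
  (forall n i j, 0 <= B n i j) -> (forall n i j, 0 <= C n i j) ->
  mx_sums B S -> mx_sums C T ->
  mx_sums (fun n => \sum_(a < n.+1) B a *m C (n - a)%N) (S *m T).
Proof.
move=> B0 C0 BS CT; split=> i j; rewrite mxE.
rewrite [series _](_ : _ = fun n => \sum_l series
    (fun n => \sum_(a < n.+1) B a i l * C (n - a)%N l j) n).
  apply: cvgr_sum => l.
  by apply: (cauchy_product (x := fun a => B a i l) (y := fun a => C a l j)) => //;
    exact: mx_sumsP.
apply/funext => n; rewrite /series/= exchange_big/=; apply: eq_bigr => k _.
by rewrite summxE exchange_big/=; apply: eq_bigr => a _; rewrite mxE.
Qed.

(** A non-singular nonnegative matrix has no zero column, so each entry of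
    [B n] is dominated by a multiple of an entry of [M *m B n]. *)
Lemma unitmx_summable M B : M \in unitmx -> (forall i j, 0 <= M i j) ->
  (forall n i j, 0 <= B n i j) ->
  (forall i j, cvgn (series (fun n => (M *m B n) i j))) ->
  forall i j, cvgn (series (fun n => B n i j)).
Proof.
move=> Mu M0 B0 MB l j.
have [i Mil] : exists i, 0 < M i l.
  apply: contrapT => /forallNP Ml.
  have Ml0 : M *m delta_mx l l = 0.
    apply/matrixP => i k; rewrite !mxE big1// => m _; rewrite mxE.
    case: eqP => [->|_]; last by rewrite mulr0.
    have /negP := Ml i; rewrite -leNgt => h.
    by rewrite (_ : M i l = 0) ?mul0r//; apply/eqP; rewrite eq_le h M0.
  have /matrixP/(_ l l) := congr1 (mulmx (invmx M)) Ml0.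
  rewrite mulKmx// mulmx0 !mxE !eqxx/= => /eqP.
  by rewrite oner_eq0.
apply: (@series_le_cvg _ _ ((M i l)^-1 *: (fun n => (M *m B n) i j))) => [n|n|n|].
- exact: B0.
- rewrite [leRHS](_ : _ = (M i l)^-1 * (M *m B n) i j)// mulr_ge0 ?invr_ge0//.
  by rewrite mxE sumr_ge0// => k _; rewrite mulr_ge0.
- rewrite [leRHS](_ : _ = (M i l)^-1 * (M *m B n) i j)// mulrC ler_pdivlMr//.
  rewrite mxE (bigD1 l)//= mulrC lerDl sumr_ge0// => k _; exact: mulr_ge0.
- exact: is_cvg_seriesZ.
Qed.

End MatrixSeries.

Arguments mx_sumsP {R N B S} i j _ _ _.

(** * The walk killed when it leaves the positive levels *)

Section Taboo.
Context (R : realType) (N : nat) (A : int -> 'M[R]_N).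

(** The [n]-step kernel of the walk with increment matrices [A] killed on
    leaving the levels [1, 2, ...]; [x] and [y] stand for the levels [x + 1] and
    [y + 1].  The bound on [z] expresses that jumps are at most 1. *)
Fixpoint taboo (n x y : nat) : 'M[R]_N :=
  if n is n'.+1 then \sum_(z < x.+2) A (z%:Z - x%:Z) *m taboo n' z y
  else (x == y)%:R%:M.

Lemma taboo0 x y : taboo 0 x y = (x == y)%:R%:M. Proof. by []. Qed.

Lemma tabooS n x y :
  taboo n.+1 x y = \sum_(z < x.+2) A (z%:Z - x%:Z) *m taboo n z y.
Proof. by []. Qed.

Arguments taboo : simpl never.

Hypothesis A_ge0 : forall d i j, 0 <= A d i j.
Hypothesis A_gt1 : forall d, 1 < d -> A d = 0.

Lemma taboo_ge0 n x y i j : 0 <= taboo n x y i j.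
Proof.
elim: n x i j => [|n IH] x i j.
  by rewrite taboo0 mxE mulrn_wge0.
rewrite tabooS summxE; apply: sumr_ge0 => z _; rewrite mxE; apply: sumr_ge0 => l _.
by rewrite mulr_ge0.
Qed.

(** The Markov property of a process yields its law at time [n + 1] from the
    one at time [n], whence this form of the recursion; after [n] steps the
    walk is at most [n] levels above its start, so any large [M] will do. *)
Lemma taboo_last M n x y : (x + n < M)%N ->
  taboo n.+1 x y = \sum_(z < M) taboo n x z *m A (y%:Z - z%:Z).
Proof.
elim: n x => [|n IH] x xnM.
  under [RHS]eq_bigr do rewrite taboo0.
  rewrite tabooS [RHS](bigD1 (Ordinal (leq_ltn_trans (leq_addr 0 x) xnM)))//=.
  rewrite eqxx mul1mx [X in _ = _ + X]big1 ?addr0 => [|z zx]; last first.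
    have -> : (x == z :> nat) = false by rewrite eq_sym; apply/negbTE.
    by rewrite raddf0 mul0mx.
  have [yx|xy] := ltnP y x.+2.
    rewrite (bigD1 (Ordinal yx))//= taboo0 eqxx mulmx1 big1 ?addr0// => z zy.
    rewrite taboo0; have -> : (z == y :> nat) = false by apply/negbTE.
    by rewrite raddf0 mulmx0.
  rewrite A_gt1; last by lia.
  rewrite big1 ?mulmx0// => z _; rewrite taboo0.
  have -> : (z == y :> nat) = false by have := ltn_ord z; lia.
  by rewrite raddf0 mulmx0.
rewrite tabooS (eq_bigr (fun z : 'I_x.+2 => \sum_(t < M)
    A (z%:Z - x%:Z) *m taboo n z t *m A (y%:Z - t%:Z))) => [|z _].
  by rewrite exchange_big/=; apply: eq_bigr => t _; rewrite mulmx_suml.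
rewrite IH; last by have := ltn_ord z; lia.
by rewrite mulmx_sumr; apply: eq_bigr => t _; rewrite mulmxA.
Qed.

(** Split the paths according to their last visit to the lowest positive level,
    at time [a].  As jumps are at most 1 the next step leads to the level just
    above, and from then on that level plays the role of the lowest one.  Paths
    without such a visit form the first term. *)
Lemma taboo_last_exit n x y :
  taboo n x y.+1 = (if x is x'.+1 then taboo n x' y else 0) +
    \sum_(a < n) taboo a x 0 *m A 1 *m taboo (n.-1 - a) 0 y.
Proof.
elim: n x => [|n IH] x.
  by rewrite big_ord0 addr0; case: x => [|x]; rewrite !taboo0/= ?raddf0.
rewrite tabooS; under eq_bigr do rewrite IH mulmxDr.
rewrite big_split/= [X in _ + X = _](_ : _ = \sum_(a < n)
    taboo a.+1 x 0 *m A 1 *m taboo (n.-1 - a) 0 y); last first.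
  under eq_bigr do rewrite mulmx_sumr.
  rewrite exchange_big/=; apply: eq_bigr => a _.
  by rewrite tabooS !mulmx_suml; apply: eq_bigr => z _; rewrite !mulmxA.
rewrite [in RHS]big_ord_recl/= subn0.
rewrite [X in _ = _ + (_ + X)](_ : _ = \sum_(a < n)
    taboo a.+1 x 0 *m A 1 *m taboo (n.-1 - a) 0 y); last first.
  apply: eq_bigr => a _; rewrite /bump/=; congr (_ *m taboo _ _ _).
  by have := ltn_ord a; lia.
rewrite addrA; congr (_ + _); rewrite big_ord_recl/= mulmx0 add0r.
case: x => [|x].
  by rewrite taboo0 eqxx mul1mx big_ord1/= /bump/= subr0 add0r.
rewrite (taboo0 x.+1)/= raddf0 !mul0mx addr0 tabooS.
apply: eq_bigr => z _; rewrite /bump/=; congr (A _ *m _); lia.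
Qed.

Variable v : R.
Hypothesis v_gt0 : 0 < v.

(** The convergence of this series is established below in [green_sums]. *)
Definition green x y : 'M[R]_N := mx_series (fun n => v ^+ n *: taboo n x y).

Variable Rv : 'M[R]_N.
Hypothesis A1_unit : A 1 \in unitmx.
Hypothesis Rv_sums : mx_sums (fun n => v ^+ n.+1 *: (A 1 *m taboo n 0 0)) Rv.

Let C := v *: A 1.

Let C_unit : C \in unitmx.
Proof. by rewrite unitmxZ// unitfE gt_eqF. Qed.

Let C_ge0 i j : 0 <= C i j.
Proof. by rewrite mxE mulr_ge0// ltW. Qed.

Let t n x y := v ^+ n *: taboo n x y.

Let t_ge0 n x y i j : 0 <= t n x y i j.
Proof. by rewrite mxE mulr_ge0 ?taboo_ge0// exprn_ge0// ltW. Qed.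

Let tS n x y : t n.+1 x y = v *: \sum_(z < x.+2) A (z%:Z - x%:Z) *m t n z y.
Proof.
rewrite /t exprS tabooS -scalerA scaler_sumr.
by congr (_ *: _); apply: eq_bigr => z _; rewrite -scalemxAr.
Qed.

Let sums00 : mx_sums (fun n => t n 0 0) (green 0 0).
Proof.
apply: mx_sums_series; apply: (unitmx_summable C_unit C_ge0) => [n|i j].
  exact: t_ge0.
rewrite (_ : (fun n => _) = fun n => (v ^+ n.+1 *: (A 1 *m taboo n 0 0)) i j).
  exact: cvgP _ (mx_sumsP i j Rv_sums).
by apply/funext => n; rewrite /C /t -scalemxAl -scalemxAr scalerA exprS.
Qed.

Let Rv_green00 : C *m green 0 0 = Rv.
Proof.
apply: (mx_sums_uniq (mx_sums_mull C sums00)).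
apply: mx_sums_eq Rv_sums => n.
by rewrite /C /t -scalemxAl -scalemxAr scalerA exprS.
Qed.

(* The last exit decomposition is a convolution in time. *)
Let sums0S y G : mx_sums (fun n => t n 0 y) G ->
  mx_sums (fun n => t n 0 y.+1) (green 0 0 *m C *m G).
Proof.
move=> yG; have t0 : t 0 0 y.+1 = 0 by rewrite /t taboo0/= raddf0 scaler0.
rewrite -[_ *m G]add0r -t0.
apply: mx_sums_recl.
have : mx_sums (fun n => \sum_(a < n.+1) (t a 0 0 *m C) *m t (n - a) 0 y)
    (green 0 0 *m C *m G).
  apply: mx_sums_cauchy (mx_sums_mulr C sums00) yG => n i j; last exact: t_ge0.
  by rewrite mxE sumr_ge0// => k _; rewrite mulr_ge0.
apply: mx_sums_eq => n; rewrite /t taboo_last_exit add0r scaler_sumr.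
apply: eq_bigr => a _; rewrite /C -scalemxAr.
rewrite -[(_ *: _) *m (_ *: _)]scalemxAr -!scalemxAl !scalerA.
congr (_ *: _); rewrite -exprSr -exprD; congr (_ ^+ _).
by have := ltn_ord a; lia.
Qed.

Let sums0 y : mx_sums (fun n => t n 0 y) (green 0 y).
Proof.
elim: y => [|y /sums0S h]; first exact: sums00.
by apply: mx_sums_series => i j; exact: cvgP _ (mx_sumsP i j h).
Qed.

(** Comparison with the first-step equation: [v A_1] times the [n]-th term of
    [green x.+1 y] is part of the [(n + 1)]-th term of [green x y]. *)
Lemma green_sums x y : mx_sums (fun n => v ^+ n *: taboo n x y) (green x y).
Proof.
elim: x => [|x IH]; first exact: sums0.
apply: mx_sums_series; apply: (unitmx_summable C_unit C_ge0) => [n|i j].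
  exact: t_ge0.
apply: (@series_le_cvg _ _ (fun n => t n.+1 x y i j)) => [n|n|n|]; last 1 first.
- have h := mx_sumsP i j IH; rewrite -cvg_shiftS in h.
  rewrite [series _](_ : _ = fun n => series (fun n => t n x y i j) n.+1 - t 0 x y i j).
    by apply: is_cvgB; [exact: cvgP _ h|exact: is_cvg_cst].
  by apply/funext => n; rewrite /series/= big_nat_recl//= addrC addKr.
- by rewrite mxE sumr_ge0// => k _; rewrite mulr_ge0 ?t_ge0.
- exact: t_ge0.
- rewrite -/(t n x.+1 y) tS big_ord_recr/= (_ : x.+1%:Z - x%:Z = 1); last by lia.
  rewrite scalerDr scalemxAl [leRHS]mxE lerDr !mxE mulr_ge0 ?(ltW v_gt0)//.
  rewrite summxE sumr_ge0// => z _; rewrite mxE sumr_ge0// => k _.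
  by rewrite mulr_ge0.
Qed.

Lemma green_first_step x y : v *: (\sum_(z < x.+2) A (z%:Z - x%:Z) *m green z y) =
  green x y - (x == y)%:R%:M.
Proof.
apply/eqP; rewrite -subr_eq opprK addrC; apply/eqP.
have t0E : t 0 x y = (x == y)%:R%:M by rewrite /t expr0 scale1r taboo0.
rewrite -t0E; suff h : mx_sums (fun n => t n.+1 x y)
    (v *: \sum_(z < x.+2) A (z%:Z - x%:Z) *m green z y).
  exact: mx_sums_uniq (mx_sums_recl h) (green_sums x y).
apply: (@mx_sums_eq _ _ (fun n => v%:M *m \sum_(z < x.+2) A (z%:Z - x%:Z) *m t n z y)).
  by move=> n; rewrite mul_scalar_mx tS.
rewrite -mul_scalar_mx; apply: mx_sums_mull; apply: mx_sums_sum => z.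
exact/mx_sums_mull/green_sums.
Qed.

(** Going from level 0 to level [y + 1] without coming back to 0 decomposes
    into [y + 1] passages from a level to the next one. *)
Lemma green0_pow y : v *: (A 1 *m green 0 y) = Rv ^+ y.+1.
Proof.
rewrite scalemxAl -/C; elim: y => [|y IH]; first by rewrite Rv_green00 expr1.
rewrite (mx_sums_uniq (green_sums 0 y.+1) (sums0S (green_sums 0 y))).
rewrite -(mulmxA (green 0 0)) (mulmxA C) Rv_green00 IH.
by rewrite [RHS]exprS.
Qed.

(** Both sides satisfy the first-step equation, which is a recursion in [x]
    because [A 1] can be cancelled. *)
Lemma green_scale (W : int -> 'M[R]_N) : (forall d, d <= 0 -> W d = 0) ->
  v *: (A 1 *m W 1) = 1%:M ->
  (forall x : nat, v *: (\sum_(z < x.+2) A (z%:Z - x%:Z) *m W z.+1%:Z) = W x.+1%:Z) ->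
  forall x y, green x y = W x.+1%:Z *m Rv ^+ y.+1 - W (x%:Z - y%:Z).
Proof.
move=> W0 W1 WS x y; pose H (x : nat) := W x.+1%:Z *m Rv ^+ y.+1 - W (x%:Z - y%:Z).
have Wshift (s : nat) : v *: (\sum_(z < s.+2) A (z%:Z - s%:Z) *m W (z%:Z - y%:Z)) =
    W (s%:Z - y%:Z) + (s == y)%:R%:M.
  have [sy|ys|->] := ltngtP s y.
  - rewrite (W0 (s%:Z - _)) ?raddf0 ?addr0; last by lia.
    rewrite big1 ?scaler0// => z _; rewrite W0 ?mulmx0//.
    by have := ltn_ord z; lia.
  - have [e ->] : exists e, s = (y.+1 + e)%N by exists (s - y.+1)%N; lia.
    rewrite -!addnS big_split_ord/= big1 => [|z _]; last first.
      by rewrite W0 ?mulmx0//; have := ltn_ord z; lia.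
    rewrite add0r raddf0 addr0 (_ : _%:Z - y%:Z = e.+1%:Z) ?WS; last by lia.
    rewrite -WS; congr (_ *: _); apply: eq_bigr => z _.
    by congr (A _ *m W _); lia.
  - rewrite subrr W0// add0r big_ord_recr/= big1 => [|z _]; last first.
      by rewrite W0 ?mulmx0//; have := ltn_ord z; lia.
    by rewrite add0r -W1; congr (_ *: (A _ *m W _)); lia.
have Hstep s : v *: (\sum_(z < s.+2) A (z%:Z - s%:Z) *m H z) = H s - (s == y)%:R%:M.
  rewrite /H; under eq_bigr do rewrite mulmxBr mulmxA.
  by rewrite sumrB scalerBr Wshift -mulmx_suml scalemxAl WS opprD addrA.
rewrite -/(H x); have [n] := ubnP x; elim: n x => [//|n IH] [|x] xn.
  apply: (can_inj (mulKmx C_unit)); rewrite -[in LHS]scalemxAl green0_pow.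
  rewrite /H mulmxBr mulmxA /C -scalemxAl W1 mul1mx W0 ?mulmx0 ?subr0//.
  by lia.
apply: (can_inj (mulKmx C_unit)); rewrite /C -!scalemxAl.
have := green_first_step x y; rewrite (IH x) // -Hstep.
rewrite [in LHS]big_ord_recr [in RHS]big_ord_recr/= (_ : x.+1%:Z - x%:Z = 1); last by lia.
rewrite (eq_bigr (fun z : 'I_x.+1 => A (z%:Z - x%:Z) *m H z)) => [|z _].
  by rewrite !scalerDr => /addrI.
by rewrite IH//; have := ltn_ord z; lia.
Qed.

End Taboo.

(** * Series in the extended reals and first times *)

Section Series.
Context (R : realType).
Implicit Types f : nat -> \bar R.
Local Open Scope ereal_scope.

Lemma nneseries_finite f M : (forall n, 0 <= f n) ->
  (forall n, (M <= n)%N -> f n = 0) -> \sum_(n <oo) f n = \sum_(n < M) f n.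
Proof.
move=> f0 fM; rewrite (nneseries_split 0 M)// add0n [X in _ + X]eseries0//.
  by rewrite adde0 big_mkord.
by move=> n Mn _; exact: fM.
Qed.

Lemma nneseries_single f n0 : (forall n, 0 <= f n) ->
  (forall n, n <> n0 -> f n = 0) -> \sum_(n <oo) f n = f n0.
Proof.
move=> f0 fn; rewrite (nneseries_finite (M := n0.+1))//; last first.
  by move=> n nn0; apply: fn; lia.
rewrite big_ord_recr/= big1 ?add0e// => i _; apply: fn.
by have := ltn_ord i; lia.
Qed.

Lemma nneseries_series (x : nat -> R) (s : R) : (forall n, 0 <= x n)%R ->
  \sum_(n <oo) (x n)%:E = s%:E -> series x @ \oo --> s.
Proof.
move=> x0 xs; have cx : cvgn (series x).
  by apply: nnseries_is_cvg => //; rewrite xs ltry.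
suff -> : s = limn (series x) by [].
apply: EFin_inj; rewrite -xs -EFin_lim//; apply/congr_lim/funext => n /=.
by rewrite /series/= sumEFin.
Qed.

Lemma series_nneseries (x : nat -> R) (s : R) :
  series x @ \oo --> s -> \sum_(n <oo) (x n)%:E = s%:E.
Proof.
move=> xs; rewrite -(cvg_lim _ xs)// -EFin_lim; last exact: cvgP _ xs.
by apply/congr_lim/funext => n /=; rewrite /series/= sumEFin.
Qed.

End Series.

Section FirstTime.
Implicit Type p : pred nat.

Lemma first_timeE p n : p n -> (forall l, (l < n)%N -> ~~ p l) ->
  first_time p = Some n.
Proof.
move=> pn pl; rewrite /first_time; case: pselect => [h|[]]; last by exists n.
case: ex_minnP => m pm mmin; congr Some; apply/eqP; rewrite eqn_leq mmin//=.
by rewrite leqNgt; apply/negP => /pl; rewrite pm.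
Qed.

Lemma first_time_some p n : first_time p = Some n ->
  p n /\ forall l, (l < n)%N -> ~~ p l.
Proof.
rewrite /first_time; case: pselect => // h; case: ex_minnP => m pm mmin [<-].
split=> // l lm; apply/negP => /mmin; lia.
Qed.

End FirstTime.

(** * Markov property on events determined by the past *)

Section MeasureSplit.
Context (R : realType) (d : measure_display) (T : measurableType d).
Variable mu : {measure set T -> \bar R}.
Local Open Scope ereal_scope.

Lemma measure_split_nat (f : T -> nat) (E : set T) :
  (forall n, measurable (E `&` [set w | f w = n])) ->
  mu E = \sum_(n <oo) mu (E `&` [set w | f w = n]).
Proof.
move=> mE; rewrite [in LHS](_ : E = \bigcup_n (E `&` [set w | f w = n])).
  rewrite measure_semi_bigcup//; last exact: bigcup_measurable.
  apply/trivIsetP => i j _ _ ij; apply/seteqP; split=> // w [[_ /= fi] [_ /= fj]].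
  by move: ij; rewrite -fi -fj eqxx.
by apply/seteqP; split=> [w Ew|w [n _ []]//]; exists (f w).
Qed.

Lemma measure_split_ord N (f : T -> 'I_N) (E : set T) :
  (forall a, measurable (E `&` [set w | f w = a])) ->
  mu E = \sum_a mu (E `&` [set w | f w = a]).
Proof.
move=> mE; rewrite (@measure_split_nat f) => [|n]; last first.
  have [nN|Nn] := ltnP n N.
    rewrite [X in _ `&` X](_ : _ = [set w | f w = Ordinal nN])//.
    by apply/seteqP; split=> w /=; [move=> fn; apply: val_inj|move=> ->].
  rewrite [X in measurable X](_ : _ = set0)//.
  by apply/seteqP; split=> // w [_ /= fn]; have := ltn_ord (f w); lia.
rewrite (nneseries_finite (M := N)) => [|//|n Nn]; last first.
  rewrite [X in mu X](_ : _ = set0) ?measure0//.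
  by apply/seteqP; split=> // w [_ /= fn]; have := ltn_ord (f w); lia.
apply: eq_bigr => a _; congr (mu (_ `&` _)).
by apply/seteqP; split=> w /=; [move=> fn; apply: val_inj|move=> ->].
Qed.

End MeasureSplit.

Arguments measure_split_nat {R d T} mu f E _.
Arguments measure_split_ord {R d T} mu {N} f E _.

Section Modulated.
Context (R : realType) (N : nat) (d : measure_display) (T : measurableType d).
Context (S : countType) (P : 'I_N -> probability T R) (Y : nat -> T -> S)
  (J : nat -> T -> 'I_N) (K : S -> 'M[R]_N).
Hypothesis PYJ : modulated P Y J K.
Local Open Scope ereal_scope.

(** Records the past in a countable type, so that each event of the past is a
    countable union of atoms. *)
Definition history n w : 'I_N * seq (S * 'I_N) :=
  (J 0%N w, [seq (Y l w, J l w) | l <- iota 1 n]).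

Definition determined n (E : set T) : Prop :=
  forall w w', history n w = history n w' -> E w -> E w'.

Lemma history_eqP n w w' : history n w = history n w' <->
  (forall l, (l <= n)%N -> J l w = J l w') /\
  (forall l, (1 <= l <= n)%N -> Y l w = Y l w').
Proof.
split=> [[J0 /eq_in_map h]|[hJ hY]].
  have {}h l : (1 <= l <= n)%N -> (Y l w, J l w) = (Y l w', J l w').
    by move=> ln; apply: h; rewrite mem_iota; lia.
  by split=> [[//|l] ln|l /h[]//]; case: (h l.+1 ln).
rewrite /history hJ//; congr (_, _); apply/eq_in_map => l; rewrite mem_iota => ln.
by rewrite hJ ?hY//; lia.
Qed.

Lemma past_history n w0 :
  past Y J n (Y^~ w0) (J^~ w0) = [set w | history n w = history n w0].
Proof. by apply/seteqP; split=> w /= /history_eqP. Qed.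

Lemma measurable_past n y j : measurable (past Y J n y j).
Proof.
have [mY mJ _ _] := PYJ.
rewrite [X in measurable X](_ : _ =
  (\bigcap_(l in [set l | (l <= n)%N]) [set w | J l w = j l]) `&`
  (\bigcap_(l in [set l | (1 <= l <= n)%N]) [set w | Y l w = y l])); last first.
  by apply/seteqP; split.
apply: measurableI; apply: bigcap_measurableType => -[|l]//= _.
Qed.

Let code n w := pickle (history n w).

(* An atom either lies in E, and is then a past event, or misses E. *)
Let fiberP n c (E : set T) : determined n E ->
  (exists w0, E w0 /\ E `&` [set w | code n w = c] = past Y J n (Y^~ w0) (J^~ w0)) \/
  E `&` [set w | code n w = c] = set0.
Proof.
move=> dE; have [[w0 [Ew0 cw0]]|] := pselect (exists w0, E w0 /\ code n w0 = c).
  left; exists w0; split=> //; rewrite past_history; apply/seteqP; split=> w /=.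
    by move=> [_]; rewrite -cw0 => /(pcan_inj pickleK).
  by move=> hw; split; [exact: dE (esym hw) Ew0|rewrite -cw0 /code hw].
move=> /forallNP h; right; apply/seteqP; by split=> // w [Ew cw]; apply: (h w).
Qed.

Lemma measurable_determined n E : determined n E -> measurable E.
Proof.
move=> dE; rewrite [E](_ : _ = \bigcup_c (E `&` [set w | code n w = c])).
  apply: bigcup_measurable => c _.
  by have [[w0 [_ ->]]|->] := fiberP c dE; [exact: measurable_past|].
by apply/seteqP; split=> [w Ew|w [c _ []]//]; exists (code n w).
Qed.

Lemma measurable_next n s b : measurable [set w | Y n.+1 w = s /\ J n.+1 w = b].
Proof. have [mY mJ _ _] := PYJ.
exact: (measurableI [set w | Y n.+1 w = s] [set w | J n.+1 w = b]).
 Qed.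

(** The atoms of the past are countably many, so the one-step law extends to
    every event determined by the past. *)
Lemma markov i n E a s b : determined n E ->
  P i (E `&` [set w | J n w = a] `&` [set w | Y n.+1 w = s /\ J n.+1 w = b]) =
  P i (E `&` [set w | J n w = a]) * (K s a b)%:E.
Proof.
move=> dE; have [_ _ _ PK] := PYJ; set D := E `&` [set w | J n w = a].
have dD : determined n D.
  move=> w w' h [Ew Jw]; split; first exact: dE h Ew.
  by have [hJ _] := (history_eqP n w w').1 h; rewrite /= -hJ.
have mfib c : measurable (D `&` [set w | code n w = c]).
  by have [[w0 [_ ->]]|->] := fiberP c dD; [exact: measurable_past|].
rewrite (measure_split_nat _ (code n)) => [|c]; last first.
  by rewrite setIAC; apply: measurableI => //; exact: measurable_next.
rewrite [in RHS](measure_split_nat _ (code n))// muleC.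
rewrite -nneseriesZl//; apply: eq_eseriesr => c _; rewrite setIAC muleC.
have [[w0 [[_ /= Jw0] ->]]|->] := fiberP c dD; last by rewrite set0I measure0 mul0e.
by rewrite PK Jw0.
Qed.

End Modulated.

(** * Walks driven by a modulated sequence *)

Section Walk.
Context (R : realType) (N : nat) (d : measure_display) (T : measurableType d).
Context (S : countType) (P : 'I_N -> probability T R) (Y : nat -> T -> S)
  (J : nat -> T -> 'I_N) (K : S -> 'M[R]_N).
Hypothesis PYJ : modulated P Y J K.
Hypothesis K_ge0 : forall s a b, 0 <= K s a b.
Variables (h : S -> int) (A : int -> 'M[R]_N) (x0 : nat).
Hypothesis h_inj : injective h.
Hypothesis Ah : forall s, A (h s) = K s.
Hypothesis A_out : forall z, (forall s, h s <> z) -> A z = 0.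
Local Open Scope ereal_scope.

Definition level n w : int := x0.+1%:Z + \sum_(1 <= l < n.+1) h (Y l w).

Definition alive n k a : set T :=
  [set w | (forall l, (l <= n)%N -> (1 <= level l w)%R) /\ level n w = k.+1%:Z]
    `&` [set w | J n w = a].

Let next n z b : set T := [set w | h (Y n.+1 w) = z /\ J n.+1 w = b].

Lemma level0 w : level 0 w = x0.+1%:Z.
Proof. by rewrite /level big_geq ?addr0. Qed.

Lemma levelS n w : level n.+1 w = (level n w + h (Y n.+1 w))%R.
Proof. by rewrite /level big_nat_recr//= addrA. Qed.

Let A_ge0 z a b : (0 <= A z a b)%R.
Proof.
have [[s <-]|hz] := pselect (exists s, h s = z); first by rewrite Ah.
by rewrite A_out ?mxE// => s hs; apply: hz; exists s.
Qed.

Let level_history n l w w' : (l <= n)%N ->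
  history Y J n w = history Y J n w' -> level l w = level l w'.
Proof.
move=> ln /history_eqP[_ hY]; rewrite /level; congr +%R.
by apply: eq_big_nat => k kl; rewrite hY//; lia.
Qed.

Let determined_alive n k : determined Y J n
  [set w | (forall l, (l <= n)%N -> (1 <= level l w)%R) /\ level n w = k.+1%:Z].
Proof.
move=> w w' hw [w1 wk]; split=> [l ln|]; last by rewrite -(level_history _ hw).
by rewrite -(level_history ln hw) w1.
Qed.

Lemma measurable_alive n k a : measurable (alive n k a).
Proof.
have [_ mJ _ _] := PYJ; apply: measurableI; last exact: mJ.
by apply: (measurable_determined PYJ); exact: determined_alive.
Qed.

Lemma alive_next i n k a z b :
  P i (alive n k a `&` next n z b) = P i (alive n k a) * (A z a b)%:E.
Proof.
have [[s hs]|hz] := pselect (exists s, h s = z).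
  rewrite -hs Ah -(markov PYJ)//.
  congr (P i (_ `&` _)); apply/seteqP; split=> w [hY Jb]; split=> //.
    exact: h_inj.
  by rewrite hY.
rewrite A_out ?mxE ?mule0; last by move=> s hs; apply: hz; exists s.
rewrite [X in P i X](_ : _ = set0) ?measure0//.
by apply/seteqP; split=> // w [_ [hw _]]; apply: hz; exists (Y n.+1 w).
Qed.

Lemma measurable_alive_next n k a z b : measurable (alive n k a `&` next n z b).
Proof.
have [[s hs]|hz] := pselect (exists s, h s = z).
  apply: measurableI; first exact: measurable_alive.
  rewrite [next _ _ _](_ : _ = [set w | Y n.+1 w = s /\ J n.+1 w = b]).
    exact: measurable_next PYJ _ _ _.
  apply/seteqP; split=> w [hY Jb]; split=> //; last by rewrite hY.
  by apply: h_inj; rewrite hs.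
rewrite [X in measurable X](_ : _ = set0)//.
by apply/seteqP; split=> // w [_ [hw _]]; apply: hz; exists (Y n.+1 w).
Qed.

Lemma alive0 i k a : P i (alive 0 k a) = ((k == x0) && (a == i))%:R%:E.
Proof.
have [_ mJ PJ _] := PYJ; have [->|kx0] := eqVneq k x0; last first.
  rewrite [alive _ _ _](_ : _ = set0) ?measure0//.
  by apply/seteqP; split=> // w [[_ /=]]; rewrite level0; move/eqP: kx0; lia.
have -> : alive 0 x0 a = [set w | J 0%N w = a].
  apply/seteqP; split=> w; first by case.
  move=> Jw; split=> //; split=> [l|]; last exact: level0.
  by rewrite leqn0 => /eqP ->; rewrite level0.
have [->|ai] := eqVneq a i; first exact: PJ.
apply/eqP; rewrite eq_le measure_ge0 andbT.
apply: (@le_trans _ _ (P i (~` [set w | J 0%N w = i]))).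
  apply: le_measure; rewrite ?inE//; first exact: measurableC.
  by move=> w /= ->; apply/eqP.
by rewrite probability_setC// PJ subee.
Qed.

(** Sum over the level and the phase at time [n]. *)
Lemma aliveS i n k b : P i (alive n.+1 k b) =
  \sum_(y <oo) \sum_a P i (alive n y a) * (A (k%:Z - y%:Z) a b)%:E.
Proof.
have split_eq y a : alive n.+1 k b `&` [set w | `|level n w|.-1%N = y]
    `&` [set w | J n w = a] = alive n y a `&` next n (k%:Z - y%:Z) b.
  apply/seteqP; split=> w.
    move=> [[[[w1 wk] Jb] wy] Ja]; have wn := w1 n (leqnSn n).
    have lny : level n w = y.+1%:Z by move: wy wn => /=; lia.
    split; first by split=> //; split=> // l ln; apply: w1; exact: leqW.
    by split=> //; move: wk; rewrite /= levelS lny; lia.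
  move=> [[[w1 wy] Ja] [hk Jb]].
  have wS : level n.+1 w = k.+1%:Z by rewrite levelS wy hk; lia.
  split=> //; split; last by rewrite /= wy.
  split=> //; split=> // l; rewrite leq_eqVlt => /predU1P[->|]; last exact: w1.
  by rewrite wS.
rewrite (measure_split_nat _ (fun w => `|level n w|.-1%N)) => [|y].
  apply: eq_eseriesr => y _; rewrite (measure_split_ord _ (J n)) => [|a].
    by apply: eq_bigr => a _; rewrite split_eq; exact: alive_next.
  by rewrite split_eq; exact: measurable_alive_next.
rewrite [X in measurable X](_ : _ = \bigcup_(a in [set: 'I_N])
  (alive n y a `&` next n (k%:Z - y%:Z) b)).
  by apply: fin_bigcup_measurable => // a _; exact: measurable_alive_next.
apply/seteqP; split=> [w hw|w [a _]]; first by exists (J n w) => //; rewrite -split_eq.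
by rewrite -split_eq => -[].
Qed.

Section ExitLaw.
(* the level before the exit is positive, whence the successor *)
Variable (c : nat -> nat -> nat -> R) (b : 'I_N).
Hypothesis c_ge0 : forall n k m, (0 <= c n k.+1 m)%R.

Definition exit_value (w : T) : R :=
  if first_time (fun n => level n w <= 0)%R is Some n
  then (c n `|level n.-1 w|%N `|level n w|%N * (J n w == b)%:R)%R else 0.

Let exit n k a m := alive n k a `&` next n (- (m + k.+1)%N%:Z)%R b.

Let exit_levels n k a m w : exit n k a m w ->
  [/\ first_time (fun n => level n w <= 0)%R = Some n.+1,
    level n w = k.+1%:Z, level n.+1 w = (- m%:Z)%R, J n w = a & J n.+1 w = b].
Proof.
move=> [[[w1 wk] Ja] [hw Jb]].
have wS : level n.+1 w = (- m%:Z)%R by rewrite levelS wk hw; lia.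
split=> //; apply: first_timeE => [|l ln]; first by rewrite wS; lia.
by have := w1 l ln; lia.
Qed.

Let exit_value_exit n k a m w : exit n k a m w -> exit_value w = c n.+1 k.+1 m.
Proof.
move=> /exit_levels[wn wk wm _ Jb].
by rewrite /exit_value wn/= wk wm Jb eqxx mulr1 abszN.
Qed.

Let exit_value_not_exit w : (forall n k a m, ~ exit n k a m w) -> exit_value w = 0%R.
Proof.
move=> hw; rewrite /exit_value; case E : first_time => [n|//].
have [n0 nmin] := first_time_some E.
case: n => [|n] in E n0 nmin *; first by rewrite level0 in n0.
have [Jb|_] := eqVneq (J n.+1 w) b; last by rewrite mulr0.
have wn : (0 < level n w)%R by rewrite ltNge nmin.
case: (hw n `|level n w|.-1%N (J n w) `|level n.+1 w|%N).
split; last by split=> //; move: n0 wn; rewrite levelS; lia.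
split=> //; split=> [l ln|]; last by lia.
by have := nmin l ln; lia.
Qed.

Let term n k m a w := (c n.+1 k.+1 m)%:E * (\1_(exit n k a m) w)%:E.

Let term_ge0 n k m a w : 0 <= term n k m a w.
Proof. by rewrite mule_ge0// lee_fin. Qed.

Let term0 n k m a w : ~ exit n k a m w -> term n k m a w = 0.
Proof. by move=> hw; rewrite /term indicE memNset// mule0. Qed.

Let exit_valueE w : (exit_value w)%:E =
  \sum_(n <oo) \sum_(k <oo) \sum_(m <oo) \sum_a term n k m a w.
Proof.
have [[n [k [a [m hw]]]]|hw] := pselect (exists n k a m, exit n k a m w).
  have [wn wk wm Ja _] := exit_levels hw.
  have uniq n' k' a' m' : exit n' k' a' m' w ->
      [/\ n' = n, k' = k, a' = a & m' = m].
    move=> /exit_levels[]; rewrite wn => -[<-]; rewrite wk wm Ja.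
    by move=> [<-] /oppr_inj[<-] <-.
  rewrite (nneseries_single (n0 := n)) => [|n'|n' nn].
  - rewrite (nneseries_single (n0 := k)) => [|k'|k' kk].
    + rewrite (nneseries_single (n0 := m)) => [|m'|m' mm].
      * rewrite (bigD1 a)//= big1 ?adde0 => [|a' aa].
          by rewrite /term indicE mem_set// mule1 (exit_value_exit hw).
        by apply: term0 => /uniq[_ _ e]; rewrite e eqxx in aa.
      * by apply: sume_ge0.
      * by rewrite big1// => a' _; apply: term0 => /uniq[].
    + by apply: nneseries_ge0 => m' _ _; exact: sume_ge0.
    + apply: eseries0 => m' _ _; rewrite big1// => a' _.
      by apply: term0 => /uniq[].
  - by apply: nneseries_ge0 => k' _ _; apply: nneseries_ge0 => m' _ _; exact: sume_ge0.
  - apply: eseries0 => k' _ _; apply: eseries0 => m' _ _; rewrite big1// => a' _.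
    by apply: term0 => /uniq[].
rewrite exit_value_not_exit => [|n k a m hx]; last by apply: hw; exists n, k, a, m.
symmetry; apply: eseries0 => n _ _; apply: eseries0 => k _ _.
apply: eseries0 => m _ _; rewrite big1// => a _; apply: term0 => hx.
by apply: hw; exists n, k, a, m.
Qed.

Let measurable_term n k m a : measurable_fun setT (term n k m a : T -> \bar R).
Proof.
apply: measurable_funeM; apply/measurable_EFinP; apply: measurable_indic.
exact: measurable_alive_next.
Qed.

Let measurable_term1 n k m :
  measurable_fun setT (fun w => \sum_a term n k m a w : \bar R).
Proof. by apply: emeasurable_sum => a; exact: measurable_term. Qed.

Let measurable_term2 n k :
  measurable_fun setT (fun w => \sum_(m <oo) \sum_a term n k m a w : \bar R).
Proof.
apply: ge0_emeasurable_sum => [m w _ _|m _]; last exact: measurable_term1.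
exact: sume_ge0.
Qed.

Let measurable_term3 n :
  measurable_fun setT (fun w => \sum_(k <oo) \sum_(m <oo) \sum_a term n k m a w : \bar R).
Proof.
apply: ge0_emeasurable_sum => [k w _ _|k _]; last exact: measurable_term2.
by apply: nneseries_ge0 => m _ _; exact: sume_ge0.
Qed.

Lemma measurable_exit_value : measurable_fun setT exit_value.
Proof.
apply/measurable_EFinP; rewrite (_ : EFin \o _ = fun w =>
    \sum_(n <oo) \sum_(k <oo) \sum_(m <oo) \sum_a term n k m a w).
  apply: ge0_emeasurable_sum => [n w _ _|n _]; last exact: measurable_term3.
  apply: nneseries_ge0 => k _ _; apply: nneseries_ge0 => m _ _; exact: sume_ge0.
by apply/funext => w /=; rewrite exit_valueE.
Qed.

(** The exit happens at time [n + 1] by a jump of size [- (m + k + 1)] from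
    level [k + 1] to level [- m]. *)
Lemma expectation_exit i : 'E_(P i)[exit_value] =
  \sum_(n <oo) \sum_(k <oo) \sum_(m <oo) (c n.+1 k.+1 m)%:E *
    \sum_a P i (alive n k a) * (A (- (m + k.+1)%N%:Z)%R a b)%:E.
Proof.
rewrite unlock; under eq_integral do rewrite exit_valueE.
rewrite integral_nneseries//; last first.
  move=> n w _; apply: nneseries_ge0 => k _ _; apply: nneseries_ge0 => m _ _.
  exact: sume_ge0.
apply: eq_eseriesr => n _; rewrite integral_nneseries//; last first.
  by move=> k w _; apply: nneseries_ge0 => m _ _; exact: sume_ge0.
apply: eq_eseriesr => k _; rewrite integral_nneseries//; last first.
  by move=> m w _; exact: sume_ge0.
apply: eq_eseriesr => m _; rewrite ge0_integral_sum//.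
rewrite ge0_sume_distrr => [|a _]; last by rewrite mule_ge0// lee_fin.
apply: eq_bigr => a _; rewrite ge0_integralZl//=; last first.
- by rewrite lee_fin.
- apply/measurable_EFinP; apply: measurable_indic.
  exact: measurable_alive_next.
rewrite integral_indic//; last exact: measurable_alive_next.
by rewrite setIT; congr (_ * _); exact: alive_next.
Qed.

End ExitLaw.

End Walk.

(** * Time reversal *)

Section Reversal.
Context (R : realType) (N : nat) (q : 'rV[R]_N).
Implicit Types B C : 'M[R]_N.
Hypothesis q_gt0 : forall i, 0 < q ord0 i.

Let D_unit : diag_mx q \in unitmx.
Proof.
rewrite unitmxE det_diag unitfE; apply/prodf_neq0 => i _.
by rewrite gt_eqF.
Qed.

Lemma reversal_ge0 B i j : 0 <= B j i -> 0 <= reversal q B i j.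
Proof.
move=> B0; have /matrixP/(_ i j) : diag_mx q *m reversal q B = B^T *m diag_mx q.
  by rewrite /reversal -mulmxA mulKVmx.
rewrite mul_diag_mx mul_mx_diag !mxE => e; rewrite -(pmulr_rge0 _ (q_gt0 i)) e.
by rewrite mulr_ge0// ltW.
Qed.

Lemma reversal0 : reversal q 0 = 0.
Proof. by rewrite /reversal raddf0 mulmx0 mul0mx. Qed.

Lemma reversal_scalar (a : R) : reversal q a%:M = a%:M.
Proof.
by rewrite /reversal tr_scalar_mx -mulmxA mul_scalar_mx -scalemxAr mulVmx// scalemx1.
Qed.

Lemma reversal_sum (I : finType) (B : I -> 'M[R]_N) :
  reversal q (\sum_a B a) = \sum_a reversal q (B a).
Proof.
by rewrite /reversal raddf_sum mulmx_sumr mulmx_suml.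
Qed.

Lemma reversalZ (a : R) B : reversal q (a *: B) = a *: reversal q B.
Proof. by rewrite /reversal linearZ/= -scalemxAr -scalemxAl. Qed.

Lemma reversalM B C : reversal q (B *m C) = reversal q C *m reversal q B.
Proof.
by rewrite /reversal trmx_mul !mulmxA -(mulmxA _ (diag_mx q) (invmx _)) mulmxV// mulmx1.
Qed.

Lemma reversalK B : reversal q (reversal q B) = B.
Proof.
rewrite /reversal !trmx_mul trmxK trmx_inv tr_diag_mx !mulmxA mulVmx// mul1mx.
by rewrite -mulmxA mulVmx// mulmx1.
Qed.

Lemma mx_sums_reversal (B : nat -> 'M[R]_N) (S : 'M[R]_N) :
  mx_sums B S -> mx_sums (fun n => reversal q (B n)) (reversal q S).
Proof.
move=> BS; apply: mx_sums_mulr; apply: mx_sums_mull; split=> i j.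
rewrite mxE; rewrite [X in series X](_ : _ = fun k => B k j i).
  exact: mx_sumsP.
by apply/funext => n; rewrite mxE.
Qed.

End Reversal.

(** Some state has positive mass, and irreducibility spreads it to all. *)
Lemma stationary_gt0 (R : realType) (N : nat) (q : 'rV[R]_N) (Q : 'M[R]_N) :
  (forall i j, 0 <= Q i j) -> irreducible Q -> is_stationary q Q ->
  forall i, 0 < q ord0 i.
Proof.
move=> Q0 Qirr [[q0 q1] qQ] i.
have Qn0 n a b : 0 <= (Q ^+ n) a b.
  elim: n a b => [|n IH] a b; first by rewrite expr0 mxE mulrn_wge0.
  by rewrite exprS mxE sumr_ge0// => k _; rewrite mulr_ge0.
have qQn n : q *m Q ^+ n = q.
  by elim: n => [|n IH]; [rewrite expr0 mulmx1|rewrite exprS mulmxA qQ].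
have [j qj] : exists j, 0 < q ord0 j.
  apply: contrapT => /forallNP h; have : \sum_j q ord0 j = 0.
    rewrite big1// => j _; apply/eqP; rewrite eq_le q0 andbT leNgt; exact/negP.
  by rewrite q1 => /eqP; rewrite oner_eq0.
have [n Qji] := Qirr j i; rewrite -(qQn n) mxE (bigD1 j)//=.
by rewrite ltr_wpDr ?mulr_gt0// sumr_ge0// => k _; rewrite mulr_ge0.
Qed.

Lemma phase_mx_ge0 (R : realType) (N : nat) (Lambda : nat -> 'M[R]_N) i j :
  is_kernel Lambda -> 0 <= phase_mx Lambda i j.
Proof.
move=> kL; rewrite mxE; apply: limr_ge; first exact: kernel_summable.
by near=> n; apply: sumr_ge0 => k _; case: kL.
Unshelve. all: by end_near. Qed.

(** * Ruin of the risk process *)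

Section Ruin.
Context (R : realType) (N : nat) (Lambda : nat -> 'M[R]_N).
Context (d : measure_display) (T : measurableType d) (P : 'I_N -> probability T R)
    (Z : nat -> T -> nat) (J : nat -> T -> 'I_N).
Hypothesis kL : is_kernel Lambda.
Hypothesis PZJ : modulated P Z J Lambda.
Let A := increment_mx Lambda.
(* one unit of premium minus the claim *)
Let h (z : nat) : int := 1 - z%:Z.

Let h_inj : injective h. Proof. by move=> a b; rewrite /h; lia. Qed.

Let Ah z : A (h z) = Lambda z.
Proof. by apply: increment_mxE; rewrite /h; lia. Qed.

Let A_out d' : (forall z, h z <> d') -> A d' = 0.
Proof.
move=> hd; apply: increment_mx_gt1; rewrite ltNge; apply/negP => d1.
by apply: (hd `|1 - d'|%N); rewrite /h; lia.
Qed.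

Let A_ge0 z i j : 0 <= A z i j. Proof. exact: increment_mx_ge0. Qed.

Lemma alive_ruin x n k i a :
  P i (alive Z J h x n k a) = (taboo A n x k i a)%:E.
Proof.
elim: n k a => [|n IH] k b.
  rewrite (alive0 PZJ) taboo0 mxE (eq_sym k) (eq_sym b).
  by case: (x == k); case: (i == b); rewrite ?mulr1n ?mulr0n.
have taboo_out y : (x + n < y)%N -> taboo A n x y = 0.
  elim: n x y {IH} => [|n IH] y z yz.
    by rewrite taboo0 (_ : (y == z) = false) ?raddf0//; lia.
  by rewrite tabooS big1// => s _; rewrite IH ?mulmx0//; have := ltn_ord s; lia.
rewrite (aliveS PZJ x h_inj Ah A_out).
rewrite (nneseries_finite (M := (x + n).+1)) => [|y|y xny].
- rewrite (@taboo_last _ _ A (@increment_mx_gt1 _ _ Lambda) (x + n).+1)//.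
  rewrite summxE -sumEFin; apply: eq_bigr => y _; rewrite mxE -sumEFin.
  by apply: eq_bigr => a _; rewrite IH EFinM.
- by apply: sume_ge0 => a _; rewrite mule_ge0// lee_fin.
- by rewrite big1// => a _; rewrite IH taboo_out// mxE mul0e.
Qed.

Lemma penaltyE (v : R) (omega : nat -> nat -> R) x j w :
  penalty v omega x.+1 Z J j w =
  exit_value Z J h x (fun n k m => v ^+ n * omega k m) j w.
Proof.
have levelE n : level Z h x n w = surplus x.+1 Z n w.
  elim: n => [|n IH]; first by rewrite level0 /surplus big_geq// subr0 addr0.
  by rewrite levelS IH /surplus [in RHS]big_nat_recr//= /h [n.+1%:Z]intS; ring.
rewrite /penalty /ruin_time /exit_value; under eq_fun do rewrite -levelE.
by case: first_time => // n; rewrite !levelE.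
Qed.

Variables (v : R) (omega : nat -> nat -> R).
Hypothesis v_ge0 : 0 <= v.
Hypothesis omega_ge0 : forall k l : nat, (0 < k)%N -> 0 <= omega k l.
Local Open Scope ereal_scope.

Lemma gerber_shiu_taboo x i j :
  gerber_shiu_mx P v omega Z J x.+1 i j =
  \sum_(k <oo) \sum_(m <oo) \sum_(n <oo) (v ^+ n.+1 * omega k.+1 m *
    (taboo A n x k *m A (- (m + k.+1)%N%:Z)) i j)%:E.
Proof.
rewrite /gerber_shiu_mx (_ : penalty v omega x.+1 Z J j =
    exit_value Z J h x (fun n k m => v ^+ n * omega k m)%R j); last first.
  by apply/funext => w; exact: penaltyE.
rewrite (expectation_exit PZJ _ x h_inj Ah A_out); first last.
- by move=> n k m; rewrite mulr_ge0 ?exprn_ge0// omega_ge0.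
- by case: kL.
pose t k m n := (v ^+ n.+1 * omega k.+1 m *
    (taboo A n x k *m A (- (m + k.+1)%N%:Z)) i j)%:E.
have t0 k m n : 0 <= t k m n.
  rewrite lee_fin mulr_ge0 ?mulr_ge0 ?exprn_ge0 ?omega_ge0//.
  by rewrite mxE sumr_ge0// => a _; rewrite mulr_ge0// taboo_ge0.
transitivity (\sum_(n <oo) \sum_(k <oo) \sum_(m <oo) t k m n).
  apply: eq_eseriesr => n _; apply: eq_eseriesr => k _; apply: eq_eseriesr => m _.
  rewrite /t mxE [RHS]EFinM -sumEFin; congr (_ * _); apply: eq_bigr => a _.
  by rewrite alive_ruin -EFinM.
rewrite nneseries_interchange => [|n k]; last by apply: nneseries_ge0.
by apply: eq_eseriesr => k _; rewrite nneseries_interchange.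
Qed.

(** Everything is nonnegative, so the sum over the ruin time can be carried out
    first; it produces the Green matrices. *)
Lemma gerber_shiu_green x i j (G : nat -> 'M[R]_N) :
  (forall y, mx_sums (fun n => v ^+ n *: taboo A n x y)%R (G y)) ->
  gerber_shiu_mx P v omega Z J x.+1 i j =
  v%:E * \sum_(k <oo) \sum_(m <oo)
    (omega k.+1 m * (G k *m A (- (m + k.+1)%N%:Z)%R) i j)%:E.
Proof.
move=> tG; have G0 y a b : (0 <= G y a b)%R.
  rewrite -(cvg_lim _ (mx_sumsP a b (tG y)))//.
  apply: limr_ge; first exact: cvgP _ (mx_sumsP a b (tG y)).
  near=> n; apply: sumr_ge0 => k _; rewrite mxE mulr_ge0 ?exprn_ge0//.
  exact: taboo_ge0.
have GA0 k m : (0 <= omega k.+1 m * (G k *m A (- (m + k.+1)%N%:Z)%R) i j)%R.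
  by rewrite mulr_ge0 ?omega_ge0// mxE sumr_ge0// => a _; rewrite mulr_ge0.
rewrite gerber_shiu_taboo -nneseriesZl; last first.
  by move=> k _; apply: nneseries_ge0 => m _ _; rewrite lee_fin.
apply: eq_eseriesr => k _; rewrite -nneseriesZl; last first.
  by move=> m _; rewrite lee_fin.
apply: eq_eseriesr => m _; rewrite -EFinM; apply: series_nneseries.
pose B := A (- (m + k.+1)%N%:Z)%R.
have BG := mx_sumsP i j (mx_sums_mull (v * omega k.+1 m)%R%:M (mx_sums_mulr B (tG k))).
rewrite [X in _ --> X](_ : _ = ((v * omega k.+1 m)%R%:M *m (G k *m B)) i j); last first.
  by rewrite mul_scalar_mx [RHS]mxE mulrA.
rewrite [X in series X](_ : _ = fun n => ((v * omega k.+1 m)%R%:M *m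
    ((v ^+ n *: taboo A n x k)%R *m B)) i j)//.
apply/funext => n; rewrite mul_scalar_mx -scalemxAl scalerA [RHS]mxE exprS /B.
by rewrite (mulrAC v (omega _ _)).
Unshelve. all: by end_near. Qed.

End Ruin.

(** * First passage of the reversed chain *)

Section Passage.
Context (R : realType) (N : nat) (Lambda : nat -> 'M[R]_N) (q : 'rV[R]_N).
Context (d : measure_display) (T : measurableType d) (P : 'I_N -> probability T R)
    (X : nat -> T -> int) (J : nat -> T -> 'I_N).
Let A := increment_mx Lambda.
Hypothesis kL : is_kernel Lambda.
Hypothesis q_gt0 : forall i, 0 < q ord0 i.
Hypothesis XJ : is_MAC P X J (fun m => reversal q (A m)).
Variable v : R.
Hypothesis v01 : 0 < v <= 1.

Let Y n w := X n w - X n.-1 w.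
Let PYJ : modulated P Y J (fun m => reversal q (A m)). Proof. by case: XJ. Qed.
(* The walk 1 - X starts at level 1 and leaves the positive levels exactly
   when X reaches 1. *)
Let h (s : int) : int := - s.
Let A' z := reversal q (A (- z)).

Let h_inj : injective h. Proof. exact: oppr_inj. Qed.

Let A'h s : A' (h s) = reversal q (A s). Proof. by rewrite /A' opprK. Qed.

Let A'_out z : (forall s, h s <> z) -> A' z = 0.
Proof. by move=> /(_ (- z)); rewrite /h opprK. Qed.

Let A_ge0 z i j : 0 <= A z i j. Proof. exact: increment_mx_ge0. Qed.

Let K_ge0 s i j : 0 <= reversal q (A s) i j. Proof. exact: reversal_ge0. Qed.

(** The last-step recursion of the reversed walk is, after transposition and
    conjugation by [diag_mx q], the first-step recursion of [taboo]; this
    replaces the reversal of paths. *)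
Lemma alive_passage n k i a :
  P i (alive Y J h 0 n k a) = (reversal q (taboo A n k 0) i a)%:E.
Proof.
elim: n k a => [|n IH] k b.
  rewrite (alive0 PYJ) taboo0 reversal_scalar// mxE (eq_sym b).
  by case: (k == 0%N); case: (i == b); rewrite ?mulr1n ?mulr0n.
rewrite (aliveS PYJ 0%N h_inj A'h A'_out).
rewrite (nneseries_finite (M := k.+2)) => [|y|y ky].
- rewrite tabooS reversal_sum summxE -sumEFin; apply: eq_bigr => y _.
  rewrite reversalM// mxE -sumEFin.
  by apply: eq_bigr => a _; rewrite IH EFinM /A' opprB.
- by apply: sume_ge0 => a _; rewrite mule_ge0// lee_fin K_ge0.
- rewrite big1// => a _; rewrite /A' /A increment_mx_gt1 ?reversal0 ?mxE ?mule0//.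
  by lia.
Qed.

Let passage_value j (w : T) : R :=
  if first_time (fun n => 1 <= X n w) is Some n then v ^+ n * (J n w == j)%:R else 0.

Let passage_valueE j : passage_value j = exit_value Y J h 0 (fun n _ _ => v ^+ n) j.
Proof.
apply/funext => w; have levelE n : level Y h 0 n w = 1 - X n w.
  elim: n => [|n IH]; first by rewrite level0 XJ.1 subr0.
  by rewrite levelS IH /h /Y /=; lia.
rewrite /passage_value /exit_value.
rewrite (_ : (fun n => 1 <= X n w) = fun n => level Y h 0 n w <= 0)//.
by apply/funext => n; rewrite levelE; apply/idP/idP; lia.
Qed.

Let expectation_passage i j : ('E_(P i)[passage_value j] = \sum_(n <oo)
  (v ^+ n.+1 * reversal q (A 1 *m taboo A n 0 0) i j)%:E)%E.
Proof.
have /andP[v0 v1] := v01.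
rewrite passage_valueE (expectation_exit PYJ K_ge0 0%N h_inj A'h A'_out); last first.
  by move=> *; rewrite exprn_ge0// ltW.
apply: eq_eseriesr => n _.
have A'0 m k : (0 < m + k)%N -> A' (- (m + k.+1)%N%:Z) = 0.
  by move=> mk; rewrite /A' /A increment_mx_gt1 ?reversal0//; lia.
have vn : 0 <= v ^+ n.+1 by rewrite exprn_ge0// ltW.
have term_ge0 k m : (0 <= (v ^+ n.+1)%:E * \sum_a P i (alive Y J h 0 n k a) *
    (A' (- (m + k.+1)%N%:Z) a j)%:E)%E.
  by rewrite mule_ge0 ?lee_fin// sume_ge0// => a _; rewrite mule_ge0// lee_fin K_ge0.
have term0 k m : (0 < m + k)%N -> ((v ^+ n.+1)%:E * \sum_a P i (alive Y J h 0 n k a) *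
    (A' (- (m + k.+1)%N%:Z) a j)%:E = 0)%E.
  by move=> mk; rewrite big1 ?mule0// => a _; rewrite A'0// mxE mule0.
rewrite (nneseries_single (n0 := 0%N)) => [|k|k k0].
- rewrite (nneseries_single (n0 := 0%N)) => [|//|m m0]; last by apply: term0; lia.
  rewrite reversalM// mxE EFinM -sumEFin; congr (_ * _)%E; apply: eq_bigr => a _.
  by rewrite alive_passage EFinM /A' opprK.
- by apply: nneseries_ge0.
- by apply: eseries0 => m _ _; apply: term0; lia.
Qed.

(** The upward jumps of [X] are unit jumps, so that among the exits of the walk
    [1 - X] only the one from level 1 to level 0 has positive probability. *)
Lemma passage_mx_sums :
  mx_sums (fun n => v ^+ n.+1 *: (A 1 *m taboo A n 0 0))
    (reversal q (passage_mx P v X J)).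
Proof.
have /andP[v0 v1] := v01.
apply: (@mx_sums_eq _ _ (fun n => reversal q (v ^+ n.+1 *:
    reversal q (A 1 *m taboo A n 0 0)))).
  by move=> n; rewrite reversalZ reversalK.
apply: mx_sums_reversal; split=> i j; rewrite mxE -/(passage_value j).
have val01 w : 0 <= passage_value j w <= 1.
  rewrite /passage_value; case: first_time => [n|]; last by rewrite lexx ler01.
  rewrite mulr_ge0 ?exprn_ge0 ?(ltW v0)//= mulr_ile1 ?exprn_ge0 ?(ltW v0)//.
    by rewrite exprn_ile1// ltW.
  by case: (_ == _).
have E_le1 : ('E_(P i)[passage_value j] <= 1)%E.
  rewrite -[X in (_ <= X)%E](@expectation_cst _ _ _ (P i) 1).
  apply: expectation_le => [|//|w|w|].
  - rewrite passage_valueE; apply: (measurable_exit_value PYJ 0%N h_inj).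
    by move=> *; rewrite exprn_ge0// ltW.
  - by case/andP: (val01 w).
  - by rewrite /cst ler01.
  - by apply: aeW => w; case/andP: (val01 w).
have E_ge0 : (0 <= 'E_(P i)[passage_value j])%E.
  by apply: expectation_ge0 => w; case/andP: (val01 w).
have E_fin : ('E_(P i)[passage_value j] \is a fin_num)%E.
  by rewrite ge0_fin_numE// (le_lt_trans E_le1)// ltry.
rewrite [X in series X](_ : _ = fun n => v ^+ n.+1 *
    reversal q (A 1 *m taboo A n 0 0) i j); last by apply/funext => n; rewrite mxE.
apply: nneseries_series => [n|].
  rewrite mulr_ge0 ?exprn_ge0 ?(ltW v0)// reversal_ge0// mxE sumr_ge0// => a _.
  by rewrite mulr_ge0// taboo_ge0.
by rewrite -expectation_passage fineK.
Qed.

End Passage.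

Theorem theorem6 (R : realType) (N : nat)
    (* law of the phase and of the claims *)
    (Lambda : nat -> 'M[R]_N) (alpha q : 'rV[R]_N)
    (* the risk process; P i is the law given J_0 = i *)
    (d : measure_display) (T : measurableType d) (P : 'I_N -> probability T R)
    (Z : nat -> T -> nat) (J : nat -> T -> 'I_N)
    (* the time-reversed MAC *)
    (d' : measure_display) (T' : measurableType d')
    (P' : 'I_N -> probability T' R)
    (X' : nat -> T' -> int) (J' : nat -> T' -> 'I_N)
    (v : R) (W : int -> 'M[R]_N) (omega : nat -> nat -> R) (u : nat)
    (A := increment_mx Lambda) :
  is_kernel Lambda ->
  modulated P Z J Lambda ->
  (forall i j, 'E_(P i)[(fun w => (Z 1%N w)%:R * (J 1%N w == j)%:R)%R] < +oo)%E ->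
  irreducible (phase_mx Lambda) ->
  (forall i, (mean_return_time P J i < +oo)%E) ->
  is_stationary q (phase_mx Lambda) ->
  is_distribution alpha ->
  A 1 \in unitmx ->
  net_drift q A < 0 ->
  is_MAC P' X' J' (fun m => reversal q (A m)) ->
  0 < v <= 1 ->
  is_scale_matrix v A W ->
  (forall k l : nat, (0 < k)%N -> 0 <= omega k l) ->
  (0 < u)%N ->
  let Rv := reversal q (passage_mx P' v X' J') in
  (* A (- m) = Lambda m.+1: from surplus k, a claim m + 1 leads to deficit m - k;
     the printed Lambda m is an off-by-one misprint *)
  let term i j k m : \bar R :=
    (omega k (m - k)%N *
      ((W u%:Z *m Rv ^+ k - W (u%:Z - k%:Z)) *m A (- m%:Z)) i j)%:E in
  let Phi i j : \bar R :=
    (v%:E * \sum_(1 <= k <oo) \sum_(k <= m <oo) term i j k m)%E in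
  [/\ (* the series converge in [0, +oo] *)
      forall i j,
        (forall k, (0 < k)%N ->
          cvgn (fun n => \sum_(k <= m < n) term i j k m)%E) /\
        cvgn (fun n => \sum_(1 <= k < n) \sum_(k <= m <oo) term i j k m)%E,
      forall i j, gerber_shiu_mx P v omega Z J u i j = Phi i j &
      gerber_shiu alpha P v omega Z J u =
        (\sum_i \sum_j (alpha ord0 i)%:E * Phi i j)%E].
Proof.
move=> kL PZJ _ irr _ stat _ A1 _ XJ v01 sW omega0 u0 Rv term Phi.
have /andP[v0 _] := v01.
have A0 z i j : 0 <= A z i j by exact: increment_mx_ge0.
have q0 : forall i, 0 < q ord0 i.
  by apply: stationary_gt0 irr stat => i j; exact: phase_mx_ge0.
have RvE : mx_sums (fun n => v ^+ n.+1 *: (A 1 *m taboo A n 0 0)) Rv.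
  exact (passage_mx_sums kL q0 XJ v01).
case: u u0 => [//|x] _ in term Phi *.
have greenE k : green A v x k = W x.+1%:Z *m Rv ^+ k.+1 - W (x.+1%:Z - k.+1%:Z).
  rewrite (green_scale A0 v0 A1 RvE sW.1) => [| |y].
  - by congr (_ - W _); lia.
  - exact: scale_matrix1.
  - exact: scale_matrix_harmonic.
have green_ge0 k i j : 0 <= green A v x k i j.
  have tG := mx_sumsP i j (green_sums A0 v0 A1 RvE x k).
  rewrite -(cvg_lim _ tG)//; apply: limr_ge; first exact: cvgP _ tG.
  near=> n; apply: sumr_ge0 => l _; rewrite mxE mulr_ge0 ?exprn_ge0 ?(ltW v0)//.
  exact: taboo_ge0.
have term_ge0 i j k m : (0 <= term i j k m)%E.
  (* at k = 0 the sign of omega is unknown, but the matrix difference is 0 *)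
  rewrite lee_fin; case: k => [|k].
    by rewrite expr0 mulmx1 subr0 subrr mul0mx mxE mulr0.
  rewrite mulr_ge0 ?omega0// -greenE mxE sumr_ge0// => a _.
  by rewrite mulr_ge0.
have PhiE i j : gerber_shiu_mx P v omega Z J x.+1 i j = Phi i j.
  rewrite (gerber_shiu_green kL PZJ (ltW v0) omega0 i j (green_sums A0 v0 A1 RvE x)).
  (* shift the indices: k becomes k + 1, and m becomes the overshoot m - k *)
  rewrite /Phi; congr (_ * _)%E; rewrite -[RHS]nneseries_addn => [|k]; last first.
    by apply: nneseries_ge0 => m _ _; exact: term_ge0.
  apply: eq_eseriesr => k _; rewrite addn1 -[RHS]nneseries_addn => [|m];
    last exact: term_ge0.
  by apply: eq_eseriesr => m _; rewrite /term addnK -greenE.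
split=> //.
- move=> i j; split=> [k _|]; first by apply: is_cvg_nneseries => m _ _; exact: term_ge0.
  apply: is_cvg_nneseries => k _ _; apply: nneseries_ge0 => m _ _; exact: term_ge0.
- rewrite /gerber_shiu; apply: eq_bigr => i _; apply: eq_bigr => j _.
  by rewrite PhiE.
Unshelve. all: by end_near. Qed.
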